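(* Let $(X,\mathcal T)$ be a connected $2n$-dimensional manifold with a local $T^n$-action such that the Euler class $e(X,\mathcal T)$ of the orbit map vanishes (equivalently, the orbit map $\mu_X\colon X\to B_X$ admits a $C^0$ section). Let $b_0\in\mathcal S^{(n)}B_X$ and $x_0\in\mu_X^{-1}(b_0)$. Suppose that $\mathcal S^{(0)}B_X$ is nonempty. Then $\mu_X$ induces an isomorphism ${\mu_X}_*\colon\pi_1(X,x_0)\cong\pi_1(B_X,b_0)$ of fundamental groups.
   Context: $T^n=(S^1)^n$ acts on $\mathbb C^n$ by the standard representation $u\cdot z=(u_1z_1,\dots,u_nz_n)$. $\mathrm{Aut}(T^n)$ is the group of automorphisms of $T^n$; a map $f$ is $\rho$-equivariant if $f(u\cdot x)=\rho(u)\cdot f(x)$. Let $X$ be a compact Hausdorff space. A weakly standard atlas of $X$ is an atlas $\{(U^X_\alpha,\varphi^X_\alpha)\}$ such that (i) each $\varphi^X_\alpha$ is a homeomorphism from $U^X_\alpha$ onto a $T^n$-invariant open subset of $\mathbb C^n$; (ii) on each nonempty overlap $U^X_{\alpha\beta}$ the images $\varphi^X_\alpha(U^X_{\alpha\beta})$, $\varphi^X_\beta(U^X_{\alpha\beta})$ are $T^n$-invariant and $\varphi^X_\alpha\circ(\varphi^X_\beta)^{-1}$ is a $\rho_{\alpha\beta}$-equivariant homeomorphism for some $\rho_{\alpha\beta}\in\mathrm{Aut}(T^n)$. Overlaps are assumed connected. Two such atlases are equivalent if on each nonempty overlap the transition map is $\rho$-equivariant for some $\rho$; an equivalence class $\mathcal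 T$ is a local $T^n$-action on $X$. The orbit space $B_X$ is obtained by gluing the sets $U^B_\alpha:=\varphi^X_\alpha(U^X_\alpha)/T^n$ via the maps induced by the overlap maps; the orbit map $\mu_X\colon X\to B_X$ is induced by the projections. The maps $U^B_\alpha\to\mathbb R^n_{\ge0}=\{\xi:\xi_i\ge0\}$ induced by $z\mapsto(|z_1|^2,\dots,|z_n|^2)$ make $B_X$ a $C^0$ manifold with corners; $\mathcal S^{(k)}B_X$ is the set of points sent by a chart to points with exactly $k$ nonzero coordinates. In particular $\mathcal S^{(n)}B_X$ is the interior. The Euler class $e(X,\mathcal T)$ is a Čech cohomology class on $B_X$ measuring the difference between $(X,\mathcal T)$ and its canonical model; by a theorem of the paper it vanishes if and only if $\mu_X$ has a $C^0$ section. *)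

(* Defs.v *)
From HB Require Import structures.
From mathcomp Require Import all_boot all_order all_algebra generic_quotient.
From mathcomp Require Import lra complex.
From mathcomp Require Import all_classical all_reals all_analysis.

Set Implicit Arguments.
Unset Strict Implicit.
Unset Printing Implicit Defensive.

Import Order.TTheory GRing.Theory Num.Theory.
Import numFieldNormedType.Exports.

Local Open Scope classical_set_scope.
Local Open Scope ring_scope.
Local Open Scope complex_scope.
Local Open Scope quotient_scope.

Lemma within_comp (S T U : topologicalType) (A : set S) (B : set T)
    (f : S -> T) (g : T -> U) :
  {within A, continuous f} -> {within B, continuous g} ->
  (forall x, A x -> B (f x)) -> {within A, continuous (g \o f)}.
Proof.
move=> /subspace_continuousP cf /subspace_continuousP cg AB.
apply/subspace_continuousP => x Ax.
apply: (@cvg_comp _ _ _ f g _ (within B (nbhs (f x)))); last exact: cg (AB _ Ax).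
move=> W nW; have := cf _ Ax [set y | B y -> W y] nW.
rewrite /nbhs /= /nbhs /= /within /= => fW.
near=> y => Ay; have := AB _ Ay; have : A y by [].
by near: y.
Unshelve. all: by end_near.
Qed.

Lemma cont_pair (S T U : topologicalType) (f : S -> T) (g : S -> U) :
  continuous f -> continuous g -> continuous (fun z => (f z, g z)).
Proof. by move=> cf cg z; apply: cvg_pair; [exact: cf|exact: cg]. Qed.

Lemma cont_fst (S T : topologicalType) : continuous (fst : S * T -> S).
Proof. by move=> z; exact: cvg_fst. Qed.

Lemma cont_snd (S T : topologicalType) : continuous (snd : S * T -> T).
Proof. by move=> z; exact: cvg_snd. Qed.

Lemma cont_affine (R : realType) (S : topologicalType) (k c : R) (f : S -> R) :
  continuous f -> continuous (fun z => k * f z + c).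
Proof.
move=> cf z; apply: cvgD; last exact: cvg_cst.
by apply: cvgM; [exact: cvg_cst|exact: cf].
Qed.

Lemma cont_aff1 (R : realType) (S : topologicalType) (f : S -> R) :
  continuous f -> continuous (fun z => 1 - f z).
Proof. by move=> cf z; apply: cvgB; [exact: cvg_cst|exact: cf]. Qed.

Lemma cont_aff2 (R : realType) (S : topologicalType) (f : S -> R) :
  continuous f -> continuous (fun z => 2 * f z).
Proof. by move=> cf z; apply: cvgM; [exact: cvg_cst|exact: cf]. Qed.

Section FundamentalGroup.
Context {R : realType} {X : topologicalType}.
Local Notation I01 := (`[0, 1]%classic : set R).
Implicit Types x : X.

Record loop x := Loop {
  loop_fun :> R -> X;
  loop_cont : {within I01, continuous loop_fun};
  loop0 : loop_fun 0 = x;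
  loop1 : loop_fun 1 = x }.

Arguments loop_cont {x} l : rename.

HB.instance Definition _ x := gen_eqMixin (loop x).
HB.instance Definition _ x := gen_choiceMixin (loop x).

(* [H (s, t)] is the value at parameter [t] of the loop at time [s]; the values
   of loops and homotopies outside the unit interval are irrelevant. *)
Definition homotopic x (a b : loop x) := exists H : R * R -> X,
  [/\ {within I01 `*` I01, continuous H},
      forall t, I01 t -> H (0, t) = a t,
      forall t, I01 t -> H (1, t) = b t &
      forall s, I01 s -> H (s, 0) = x /\ H (s, 1) = x].

Lemma I0 : I01 0. Proof. by rewrite /= in_itv /= lexx ler01. Qed.
Lemma I1 : I01 1. Proof. by rewrite /= in_itv /= lexx ler01. Qed.

Lemma homotopic_refl x (a : loop x) : homotopic a a.
Proof.
exists (fun st => a st.2); split=> //; last by move=> s _ /=; rewrite loop0 loop1.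
apply: (within_comp (B := I01) (f := snd)) => [||z []//].
- by apply: continuous_subspaceT; exact: cont_snd.
- exact: loop_cont.
Qed.

Lemma homotopic_sym x (a b : loop x) : homotopic a b -> homotopic b a.
Proof.
move=> [H [cH H0 H1 Hx]].
exists (fun st => H (1 - st.1, st.2)); split=> /= [|t ?|t ?|s Is].
- apply: (within_comp (f := fun st : R * R => (1 - st.1, st.2)) _ cH).
  + apply: continuous_subspaceT; apply: cont_pair; last exact: cont_snd.
    exact/cont_aff1/cont_fst.
  + by move=> [s t] [/= Is It]; split=> //=; move: Is; rewrite !in_itv /=; lra.
- by rewrite subr0 H1.
- by rewrite subrr H0.
- by apply: Hx; move: Is; rewrite /= !in_itv /=; lra.
Qed.

(* Pasting along [t <= 1/2] and [1/2 <= t]. *)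
Lemma paste_within (T : topologicalType) (D : set T) (h : T -> R)
    (f g : T -> X) : closed D -> continuous h ->
  {within D `&` [set z | h z <= 2^-1], continuous f} ->
  {within D `&` [set z | 2^-1 <= h z], continuous g} ->
  (forall z, D z -> h z = 2^-1 -> f z = g z) ->
  {within D, continuous (fun z => if h z <= 2^-1 then f z else g z)}.
Proof.
move=> clD ch cf cg fg.
rewrite (_ : D = (D `&` [set z | h z <= 2^-1]) `|` (D `&` [set z | 2^-1 <= h z])).
  apply: withinU_continuous.
  - apply: closedI => //; rewrite (_ : mkset _ = h @^-1` [set r | r <= 2^-1]) //.
    by apply: closed_comp => [z _|]; [exact: ch|exact: closed_le].
  - apply: closedI => //; rewrite (_ : mkset _ = h @^-1` [set r | 2^-1 <= r]) //.
    by apply: closed_comp => [z _|]; [exact: ch|exact: closed_ge].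
  - apply: subspace_eq_continuous cf => z; rewrite inE => -[_ /= zh].
    by rewrite /from_subspace zh.
  - apply: subspace_eq_continuous cg => z; rewrite inE => -[Dz /= zh].
    by rewrite /from_subspace; case: ifPn => // hz; rewrite fg //; apply/eqP; rewrite eq_le zh hz.
rewrite -setIUr; apply/seteqP; split=> [z Dz|z []//]; split=> //=.
by case: (leP (h z) 2^-1) => ?; [left|right; exact: ltW].
Qed.

Lemma closed_I01 : closed I01. Proof. exact: interval_closed. Qed.

Lemma closed_square : closed (I01 `*` I01).
Proof.
rewrite (_ : _ `*` _ = (fst @^-1` I01) `&` (snd @^-1` I01)) //.
apply: closedI.
  apply: (@closed_comp _ _ (fst : R * R -> R)) closed_I01 => z _; exact: cvg_fst.
apply: (@closed_comp _ _ (snd : R * R -> R)) closed_I01 => z _; exact: cvg_snd.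
Qed.

Lemma homotopic_trans x (b a c : loop x) :
  homotopic a b -> homotopic b c -> homotopic a c.
Proof.
move=> [F [cF F0 F1 Fx]] [G [cG G0 G1 Gx]].
exists (fun z => if z.1 <= 2^-1 then F (2 * z.1, z.2) else G (2 * z.1 - 1, z.2)).
split=> [|t It|t It|s Is] /=.
- apply: (paste_within (h := fst)) closed_square _ _ _ _.
  + exact: cont_fst.
  + apply: (within_comp (f := fun z : R * R => (2 * z.1, z.2)) _ cF).
      apply: continuous_subspaceT; apply: cont_pair; last exact: cont_snd.
      exact/cont_aff2/cont_fst.
    by move=> [s t] [[/= Is It] hs]; split=> //=; move: Is hs; rewrite !in_itv /=; lra.
  + apply: (within_comp (f := fun z : R * R => (2 * z.1 - 1, z.2)) _ cG).
      apply: continuous_subspaceT; apply: cont_pair; last exact: cont_snd.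
      exact/cont_affine/cont_fst.
    by move=> [s t] [[/= Is It] hs]; split=> //=; move: Is hs; rewrite !in_itv /=; lra.
  + by move=> [s t] [/= _ It] ->; rewrite mulfV // subrr G0 // F1.
- by rewrite invr_ge0 ler0n mulr0 F0.
- case: ifPn => [|_]; first by move=> h; exfalso; lra.
  by rewrite mulr1 (_ : 2 - 1 = 1) ?G1 //; lra.
- by case: ifPn => h; [apply: Fx|apply: Gx]; move: Is h;
    rewrite /= !in_itv /= -?ltNge; lra.
Qed.

Definition cat_fun (a b : R -> X) (t : R) : X :=
  if t <= 2^-1 then a (2 * t) else b (2 * t - 1).

Lemma cat_cont x (a b : loop x) : {within I01, continuous (cat_fun a b)}.
Proof.
apply: (paste_within (T := R) (h := id)) closed_I01 _ _ _ _ => [|||z _ ->].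
- by move=> z.
- apply: (within_comp (f := fun t : R => 2 * t) _ (loop_cont a)).
    by apply: continuous_subspaceT; apply: cont_aff2 => z.
  by move=> t [/=]; rewrite !in_itv /=; lra.
- apply: (within_comp (f := fun t : R => 2 * t - 1) _ (loop_cont b)).
    by apply: continuous_subspaceT; apply: cont_affine => z.
  by move=> t [/=]; rewrite !in_itv /=; lra.
- by rewrite mulfV // subrr loop0 loop1.
Qed.

Lemma cat0 x (a b : loop x) : cat_fun a b 0 = x.
Proof. by rewrite /cat_fun invr_ge0 ler0n mulr0 loop0. Qed.

Lemma cat1 x (a b : loop x) : cat_fun a b 1 = x.
Proof.
rewrite /cat_fun; case: ifPn => [|_]; first by move=> h; exfalso; lra.
by rewrite mulr1 (_ : 2 - 1 = 1) ?loop1 //; lra.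
Qed.

Arguments cat_cont {x} a b.

Definition loop_cat x (a b : loop x) := Loop (cat_cont a b) (cat0 a b) (cat1 a b).

Lemma homotopic_cat x (a a' b b' : loop x) : homotopic a a' -> homotopic b b' ->
  homotopic (loop_cat a b) (loop_cat a' b').
Proof.
move=> [F [cF F0 F1 Fx]] [G [cG G0 G1 Gx]].
exists (fun z => if z.2 <= 2^-1 then F (z.1, 2 * z.2) else G (z.1, 2 * z.2 - 1)).
split=> [|t It|t It|s Is] /=.
- apply: (paste_within (h := snd)) closed_square _ _ _ _.
  + exact: cont_snd.
  + apply: (within_comp (f := fun z : R * R => (z.1, 2 * z.2)) _ cF).
      apply: continuous_subspaceT; apply: cont_pair; first exact: cont_fst.
      exact/cont_aff2/cont_snd.
    by move=> [s t] [[/= Is It] ht]; split=> //=; move: It ht; rewrite !in_itv /=; lra.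
  + apply: (within_comp (f := fun z : R * R => (z.1, 2 * z.2 - 1)) _ cG).
      apply: continuous_subspaceT; apply: cont_pair; first exact: cont_fst.
      exact/cont_affine/cont_snd.
    by move=> [s t] [[/= Is It] ht]; split=> //=; move: It ht; rewrite !in_itv /=; lra.
  + move=> [s t] [/= Is _] ->; rewrite mulfV // subrr.
    by rewrite (Fx _ Is).2 (Gx _ Is).1.
- rewrite /cat_fun; case: ifPn => h; [apply: F0|apply: G0];
    by move: It h; rewrite /= !in_itv /= -?ltNge; lra.
- rewrite /cat_fun; case: ifPn => h; [apply: F1|apply: G1];
    by move: It h; rewrite /= !in_itv /= -?ltNge; lra.
- split; first by rewrite invr_ge0 ler0n mulr0 (Fx _ Is).1.
  case: ifPn => [|_]; first by move=> h; exfalso; lra.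
  by rewrite mulr1 (_ : 2 - 1 = 1) ?(Gx _ Is).2 //; lra.
Qed.

Definition loop_cst x : loop x.
Proof. by refine (@Loop x (cst x) _ _ _) => //; apply: continuous_subspaceT => z; exact: cvg_cst. Defined.

Lemma rev_cont x (a : loop x) : {within I01, continuous (fun t => a (1 - t))}.
Proof.
apply: (within_comp (f := fun t : R => 1 - t) _ (loop_cont a)).
  by apply: continuous_subspaceT; apply: cont_aff1 => z.
by move=> t /=; rewrite !in_itv /=; lra.
Qed.

Arguments rev_cont {x} a.

Definition loop_rev x (a : loop x) : loop x.
Proof.
refine (@Loop x (fun t => a (1 - t)) (rev_cont a) _ _).
- by rewrite subr0 loop1.
- by rewrite subrr loop0.
Defined.

Lemma homotopic_rev x (a b : loop x) :
  homotopic a b -> homotopic (loop_rev a) (loop_rev b).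
Proof.
move=> [H [cH H0 H1 Hx]].
exists (fun st => H (st.1, 1 - st.2)); split=> /= [|t It|t It|s Is].
- apply: (within_comp (f := fun st : R * R => (st.1, 1 - st.2)) _ cH).
  + apply: continuous_subspaceT; apply: cont_pair; first exact: cont_fst.
    exact/cont_aff1/cont_snd.
  + by move=> [s t] [/= Is It]; split=> //=; move: It; rewrite !in_itv /=; lra.
- by rewrite H0 //; move: It; rewrite /= !in_itv /=; lra.
- by rewrite H1 //; move: It; rewrite /= !in_itv /=; lra.
- by rewrite subr0 subrr; have [] := Hx _ Is.
Qed.

Lemma reparam_homotopic x (a b c : loop x) (p q : R -> R) :
  continuous p -> continuous q ->
  (forall t, I01 t -> I01 (p t)) -> (forall t, I01 t -> I01 (q t)) ->
  p 0 = q 0 -> p 1 = q 1 ->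
  (forall t, I01 t -> b t = a (p t)) -> (forall t, I01 t -> c t = a (q t)) ->
  homotopic b c.
Proof.
move=> cp cq Ip Iq pq0 pq1 bE cE.
pose h (z : R * R) := p z.2 + z.1 * (q z.2 - p z.2).
exists (a \o h); split=> /= [|t It|t It|s Is].
- apply: (within_comp _ (loop_cont a)).
    apply: continuous_subspaceT => z.
    have cp2 : (p \o snd) z' @[z' --> z] --> p z.2.
      by apply: (@cvg_comp _ _ _ snd p); [exact: cvg_snd|exact: cp].
    have cq2 : (q \o snd) z' @[z' --> z] --> q z.2.
      by apply: (@cvg_comp _ _ _ snd q); [exact: cvg_snd|exact: cq].
    by apply: cvgD => //; apply: cvgM; [exact: cvg_fst|exact: cvgB].
  move=> [s t] [/= + /[dup] /Ip + /Iq]; rewrite /h /= !in_itv /= => ? ? ?.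
  by nra.
- by rewrite /h /= mul0r addr0 bE.
- by rewrite /h /= mul1r addrC subrK cE.
- rewrite /h /= pq0 pq1 !subrr mulr0 !addr0 -pq0 -pq1.
  by rewrite -!bE ?loop0 ?loop1 //; [exact: I1|exact: I0].
Qed.

Lemma loop_id_aff x (a b : loop x) (p : R -> R) : continuous p ->
  (forall t, I01 t -> I01 (p t)) -> p 0 = 0 -> p 1 = 1 ->
  (forall t, I01 t -> b t = a (p t)) -> homotopic b a.
Proof.
move=> cp Ip p0 p1 bE.
by apply: (@reparam_homotopic x a b a p id) => // z.
Qed.

Lemma homotopic_catA x (a b c : loop x) :
  homotopic (loop_cat (loop_cat a b) c) (loop_cat a (loop_cat b c)).
Proof.
pose p (t : R) := Num.min (2 * t) (Num.min (1 * t + 4^-1) (2^-1 * t + 2^-1)).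
have pE t : p t = if t <= 4^-1 then 2 * t
    else if t <= 2^-1 then t + 4^-1 else 2^-1 * t + 2^-1.
  by rewrite /p /Num.min; case: (ltP (1 * t + 4^-1) (2^-1 * t + 2^-1)) => ?;
    do ?[case: ifPn; rewrite -?ltNge -?leNgt => ?]; lra.
apply: (loop_id_aff (p := p)).
- have cid : continuous (fun t : R => t) by move=> t.
  by move=> t; apply: continuous_min; [exact: cont_aff2|
    apply: continuous_min; exact: cont_affine].
- by move=> t; rewrite pE /= !in_itv /=; do ?[case: ifPn; rewrite -?ltNge -?leNgt => ?]; lra.
- by rewrite pE; do ?[case: ifPn; rewrite -?ltNge -?leNgt => ?]; lra.
- by rewrite pE; do ?[case: ifPn; rewrite -?ltNge -?leNgt => ?]; lra.
- move=> t It; rewrite pE /= /cat_fun; case: (leP t 4^-1) => ?; case: (leP t 2^-1) => ?; do ?[case: ifPn; rewrite -?ltNge -?leNgt => ?];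
    by [exfalso; lra|congr (_ _); lra].
Qed.

Lemma homotopic_cat1l x (a : loop x) : homotopic (loop_cat (loop_cst x) a) a.
Proof.
pose p (t : R) := Num.max 0 (2 * t - 1).
have pE t : p t = if t <= 2^-1 then 0 else 2 * t - 1.
  by rewrite /p /Num.max; do ?[case: ifPn; rewrite -?ltNge -?leNgt => ?]; lra.
apply: (loop_id_aff (p := p)).
- have c1 : continuous (fun t : R => 2 * t - 1) by apply: cont_affine => z.
  have c0 : continuous (cst (0 : R) : R -> R) by move=> z; exact: cvg_cst.
  by move=> t; have := continuous_max (c0 t) (c1 t).
- by move=> t; rewrite pE /= !in_itv /=; do ?[case: ifPn; rewrite -?ltNge -?leNgt => ?]; lra.
- by rewrite pE; do ?[case: ifPn; rewrite -?ltNge -?leNgt => ?]; lra.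
- by rewrite pE; do ?[case: ifPn; rewrite -?ltNge -?leNgt => ?]; lra.
- by move=> t It; rewrite pE /= /cat_fun; case: ifPn => // _; rewrite loop0.
Qed.

Lemma homotopic_cat1r x (a : loop x) : homotopic (loop_cat a (loop_cst x)) a.
Proof.
pose p (t : R) := Num.min 1 (2 * t).
have pE t : p t = if t <= 2^-1 then 2 * t else 1.
  by rewrite /p /Num.min; do ?[case: ifPn; rewrite -?ltNge -?leNgt => ?]; lra.
apply: (loop_id_aff (p := p)).
- have c1 : continuous (fun t : R => 2 * t) by apply: cont_aff2 => z.
  have c0 : continuous (cst (1 : R) : R -> R) by move=> z; exact: cvg_cst.
  by move=> t; have := continuous_min (c0 t) (c1 t).
- by move=> t; rewrite pE /= !in_itv /=; do ?[case: ifPn; rewrite -?ltNge -?leNgt => ?]; lra.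
- by rewrite pE; do ?[case: ifPn; rewrite -?ltNge -?leNgt => ?]; lra.
- by rewrite pE; do ?[case: ifPn; rewrite -?ltNge -?leNgt => ?]; lra.
- by move=> t It; rewrite pE /= /cat_fun; case: ifPn => // _; rewrite loop1.
Qed.

Lemma homotopic_catVr x (a : loop x) :
  homotopic (loop_cat a (loop_rev a)) (loop_cst x).
Proof.
pose p (t : R) := Num.min (2 * t) ((- 2) * t + 2).
have pE t : p t = if t <= 2^-1 then 2 * t else (- 2) * t + 2.
  by rewrite /p /Num.min; do ?[case: ifPn; rewrite -?ltNge -?leNgt => ?]; lra.
apply: (@reparam_homotopic x a _ _ p (cst 0)).
- have cid : continuous (fun t : R => t) by move=> t.
  by move=> t; apply: continuous_min; [exact: cont_aff2|exact: cont_affine].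
- by move=> z; exact: cvg_cst.
- by move=> t; rewrite pE /= !in_itv /=; do ?[case: ifPn; rewrite -?ltNge -?leNgt => ?]; lra.
- by move=> t _; exact: I0.
- by rewrite pE; do ?[case: ifPn; rewrite -?ltNge -?leNgt => ?]; rewrite /=; lra.
- by rewrite pE; do ?[case: ifPn; rewrite -?ltNge -?leNgt => ?]; rewrite /=; lra.
- move=> t It; rewrite pE /= /cat_fun; case: ifPn => // _ /=.
  by congr (_ _); lra.
- by move=> t _ /=; rewrite loop0.
Qed.

Lemma loop_ext x (a b : loop x) : (forall t, I01 t -> a t = b t) ->
  homotopic a b.
Proof.
by move=> ab; apply: (@reparam_homotopic x b a b id id) => // z.
Qed.

Lemma homotopic_catVl x (a : loop x) :
  homotopic (loop_cat (loop_rev a) a) (loop_cst x).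
Proof.
apply: homotopic_trans (homotopic_catVr (loop_rev a)).
apply: homotopic_cat; first exact: homotopic_refl.
by apply: loop_ext => t _ /=; rewrite subKr.
Qed.

Definition homotopicb x : rel (loop x) := fun a b => `[< homotopic a b >].

Lemma homotopicb_refl x : reflexive (@homotopicb x).
Proof. by move=> a; apply/asboolP; exact: homotopic_refl. Qed.

Lemma homotopicb_sym x : symmetric (@homotopicb x).
Proof. by move=> a b; apply/asboolP/asboolP; exact: homotopic_sym. Qed.

Lemma homotopicb_trans x : transitive (@homotopicb x).
Proof.
move=> b a c /asboolP ab /asboolP bc; apply/asboolP; exact: homotopic_trans bc.
Qed.

Canonical homotopicb_equiv x := EquivRel (@homotopicb x)
  (@homotopicb_refl x) (@homotopicb_sym x) (@homotopicb_trans x).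

Definition pi1 x := {eq_quot (homotopicb_equiv x)}.

HB.instance Definition _ x := Quotient.on (pi1 x).
HB.instance Definition _ x := Choice.on (pi1 x).

Definition pi1_class x (a : loop x) : pi1 x := \pi_(pi1 x) a.

Lemma pi1_classP x (a b : loop x) :
  pi1_class a = pi1_class b <-> homotopic a b.
Proof. by rewrite /pi1_class; split=> [/eqmodP/asboolP|ab]//; apply/eqmodP/asboolP. Qed.

Lemma pi1_classK x (g : pi1 x) : pi1_class (repr g) = g.
Proof. exact: reprK. Qed.

Definition pi1_mul x (g h : pi1 x) : pi1 x :=
  pi1_class (loop_cat (repr g) (repr h)).
Definition pi1_one x : pi1 x := pi1_class (loop_cst x).
Definition pi1_inv x (g : pi1 x) : pi1 x := pi1_class (loop_rev (repr g)).

Lemma repr_homotopic x (a : loop x) : homotopic (repr (pi1_class a)) a.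
Proof. by apply/pi1_classP; rewrite pi1_classK. Qed.

Lemma pi1_mulE x (a b : loop x) :
  pi1_mul (pi1_class a) (pi1_class b) = pi1_class (loop_cat a b).
Proof. by apply/pi1_classP; apply: homotopic_cat; exact: repr_homotopic. Qed.

Lemma pi1_invE x (a : loop x) :
  pi1_inv (pi1_class a) = pi1_class (loop_rev a).
Proof. by apply/pi1_classP; apply: homotopic_rev; exact: repr_homotopic. Qed.

Lemma pi1_mulA x : associative (@pi1_mul x).
Proof.
move=> g h k; rewrite -(pi1_classK g) -(pi1_classK h) -(pi1_classK k) !pi1_mulE.
by apply/pi1_classP/homotopic_sym; exact: homotopic_catA.
Qed.

Lemma pi1_mul1g x : left_id (pi1_one x) (@pi1_mul x).
Proof.
by move=> g; rewrite -(pi1_classK g) pi1_mulE; apply/pi1_classP/homotopic_cat1l.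
Qed.

Lemma pi1_mulg1 x : right_id (pi1_one x) (@pi1_mul x).
Proof.
by move=> g; rewrite -(pi1_classK g) pi1_mulE; apply/pi1_classP/homotopic_cat1r.
Qed.

Lemma pi1_mulVg x : left_inverse (pi1_one x) (@pi1_inv x) (@pi1_mul x).
Proof.
move=> g; rewrite -(pi1_classK g) pi1_invE pi1_mulE.
exact/pi1_classP/homotopic_catVl.
Qed.

Lemma pi1_mulgV x : right_inverse (pi1_one x) (@pi1_inv x) (@pi1_mul x).
Proof.
move=> g; rewrite -(pi1_classK g) pi1_invE pi1_mulE.
exact/pi1_classP/homotopic_catVr.
Qed.

HB.instance Definition _ x := isGroup.Build (pi1 x)
  (@pi1_mulA x) (@pi1_mul1g x) (@pi1_mulg1 x) (@pi1_mulVg x) (@pi1_mulgV x).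

End FundamentalGroup.
Arguments loop_cont {R X x} l : rename.
Arguments loop R {X} x.
Arguments pi1 R {X} x.

Section InducedMap.
Context {R : realType} {X Y : topologicalType} (f : X -> Y) (cf : continuous f).
Local Notation I01 := (`[0, 1]%classic : set R).

Lemma push_cont x (a : loop R x) : {within I01, continuous (f \o a)}.
Proof.
apply: (within_comp (B := setT) (g := f) (loop_cont a)) => //.
exact: continuous_subspaceT.
Qed.

Arguments push_cont {x} a.

Lemma loop_push0 x y (a : loop R x) : f x = y -> f (a 0) = y.
Proof. by rewrite loop0. Qed.

Lemma loop_push1 x y (a : loop R x) : f x = y -> f (a 1) = y.
Proof. by rewrite loop1. Qed.

Definition loop_push x y (fx : f x = y) (a : loop R x) : loop R y :=
  Loop (push_cont a) (loop_push0 a fx) (loop_push1 a fx).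

Definition pi1_map x y (fx : f x = y) (g : pi1 R x) : pi1 R y :=
  pi1_class (loop_push fx (repr g)).

Lemma homotopic_push x y (fx : f x = y) (a b : loop R x) :
  homotopic a b -> homotopic (loop_push fx a) (loop_push fx b).
Proof.
move=> [H [cH H0 H1 Hx]]; exists (f \o H); split=> /= [|t It|t It|s Is].
- by apply: (within_comp (B := setT) (g := f) cH) => //; exact: continuous_subspaceT.
- by rewrite H0.
- by rewrite H1.
- by have [-> ->] := Hx _ Is.
Qed.

Lemma pi1_mapE x y (fx : f x = y) (a : loop R x) :
  pi1_map fx (pi1_class a) = pi1_class (loop_push fx a).
Proof. by apply/pi1_classP; apply: homotopic_push; exact: repr_homotopic. Qed.

Lemma pi1_mapM x y (fx : f x = y) :
  {morph pi1_map fx : g h / (g * h)%g}.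
Proof.
move=> g h; rewrite -(pi1_classK g) -(pi1_classK h).
rewrite [(_ * _)%g in LHS]pi1_mulE !pi1_mapE.
rewrite [RHS]pi1_mulE; apply/pi1_classP/loop_ext => t It /=.
by rewrite /cat_fun /=; case: ifP.
Qed.

HB.instance Definition _ x y (fx : f x = y) :=
  isMultiplicative.Build _ _ (pi1_map fx) (pi1_mapM fx).

End InducedMap.

Definition group_isomorphism (G H : groupType) (f : G -> H) :=
  {morph f : g h / (g * h)%g} /\ bijective f.


(* The topology of the complex numbers, defined by the modulus. *)
HB.instance Definition _ (R : realType) := NormedModule.copy R[i] R[i]^o.

Section StandardModel.
Context {R : realType} {n : nat}.
Implicit Types (u v z w : 'rV[R[i]]_n).

Definition torus : set 'rV[R[i]]_n := [set u | forall j, `|u 0 j| = 1].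

(* Coordinatewise product: both the group law of the torus and its standard
   action. *)
Definition tact u z : 'rV[R[i]]_n := \row_j (u 0 j * z 0 j).

Definition tinvariant (A : set 'rV[R[i]]_n) :=
  forall u z, torus u -> A z -> A (tact u z).

Definition tequivariant (rho : 'rV[R[i]]_n -> 'rV[R[i]]_n)
    (A : set 'rV[R[i]]_n) (f : 'rV[R[i]]_n -> 'rV[R[i]]_n) :=
  forall u z, torus u -> A z -> f (tact u z) = tact (rho u) (f z).

Definition same_orbit z w := exists2 u, torus u & w = tact u z.

Definition moment z : 'rV[R]_n := \row_j complex.Re (`|z 0 j| ^+ 2).

End StandardModel.
Arguments torus : clear implicits.

Definition homeomorphism (S T : topologicalType) (A : set S) (B : set T)
    (f : S -> T) (g : T -> S) :=
  [/\ {within A, continuous f} /\ {within B, continuous g},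
      forall x, A x -> B (f x), forall y, B y -> A (g y),
      forall x, A x -> g (f x) = x & forall y, B y -> f (g y) = y].

(* Automorphisms of the torus as a topological group, given by a map on the
   ambient space whose values outside the torus are irrelevant. *)
Definition torus_aut (R : realType) (n : nat)
    (rho : 'rV[R[i]]_n -> 'rV[R[i]]_n) :=
  (exists rho', homeomorphism (torus R n) (torus R n) rho rho') /\
  (forall u v, torus R n u -> torus R n v -> rho (tact u v) = tact (rho u) (rho v)).

(* Outside [dom], and outside the image of [dom], the values of the two maps are
   irrelevant. *)
Record chart (R : realType) (X : topologicalType) (n : nat) := Chart {
  dom : set X;
  chart_fun :> X -> 'rV[R[i]]_n;
  chart_inv : 'rV[R[i]]_n -> X }.

Section Charts.
Context {R : realType} {X : topologicalType} {n : nat}.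
Implicit Types c d : chart R X n.

Definition is_chart c :=
  [/\ open (dom c), open (c @` dom c), tinvariant (c @` dom c) &
      homeomorphism (dom c) (c @` dom c) c (chart_inv c)].

Definition overlap c d := dom c `&` dom d.

Definition transition c d := c \o chart_inv d.

(* That the transition map is a homeomorphism between the images of the overlap
   follows from [is_chart]. *)
Definition compatible c d := overlap c d !=set0 ->
  [/\ tinvariant (c @` overlap c d), tinvariant (d @` overlap c d) &
      exists2 rho, torus_aut rho &
        tequivariant rho (d @` overlap c d) (transition c d)].

End Charts.

Record weakly_standard_atlas (R : realType) (X : topologicalType) (n : nat) := Atlas {
  idx : choiceType;
  atlas_fun :> idx -> chart R X n;
  atlas_chart : forall a, is_chart (atlas_fun a);
  atlas_cover : forall x, exists a, dom (atlas_fun a) x;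
  atlas_compatible : forall a b, compatible (atlas_fun a) (atlas_fun b);
  atlas_connected : forall a b, a != b ->
    connected (overlap (atlas_fun a) (atlas_fun b)) }.

Definition atlas_equiv (R : realType) (X : topologicalType) (n : nat)
    (A B : weakly_standard_atlas R X n) :=
  forall a b, compatible (A a) (B b).

(* [T] is an equivalence class of weakly standard atlases. *)
Definition local_torus_action (R : realType) (X : topologicalType) (n : nat)
    (T : weakly_standard_atlas R X n -> Prop) :=
  exists A, forall B, T B <-> atlas_equiv A B.

Section TorusLemmas.
Context {R : realType} {n : nat}.
Implicit Types (u v z w : 'rV[R[i]]_n).

Lemma tactA u v z : tact u (tact v z) = tact (tact u v) z.
Proof. by apply/rowP => j; rewrite !mxE mulrA. Qed.

Lemma tactC u v : tact u v = tact v u.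
Proof. by apply/rowP => j; rewrite !mxE mulrC. Qed.

Lemma torusM u v : torus R n u -> torus R n v -> torus R n (tact u v).
Proof. by move=> tu tv j; rewrite mxE normrM tu tv mulr1. Qed.

Definition torus1 : 'rV[R[i]]_n := \row_j 1.

Lemma torus_torus1 : torus R n torus1.
Proof. by move=> j; rewrite mxE normr1. Qed.

Lemma tact1 z : tact torus1 z = z.
Proof. by apply/rowP => j; rewrite !mxE mul1r. Qed.

Definition tinv u : 'rV[R[i]]_n := \row_j (u 0 j)^-1.

Lemma torusV u : torus R n u -> torus R n (tinv u).
Proof. by move=> tu j; rewrite mxE normfV tu invr1. Qed.

Lemma tactK u z : torus R n u -> tact (tinv u) (tact u z) = z.
Proof.
move=> tu; apply/rowP => j; rewrite !mxE mulKf // -normr_eq0 tu.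
exact: oner_neq0.
Qed.

Lemma same_orbit_refl z : same_orbit z z.
Proof. by exists torus1; [exact: torus_torus1|rewrite tact1]. Qed.

Lemma same_orbit_sym z w : same_orbit z w -> same_orbit w z.
Proof. by move=> [u tu ->]; exists (tinv u); [exact: torusV|rewrite tactK]. Qed.

Lemma same_orbit_trans w z t :
  same_orbit z w -> same_orbit w t -> same_orbit z t.
Proof.
by move=> [u tu ->] [v tv ->]; exists (tact v u); [exact: torusM|rewrite tactA].
Qed.

Lemma torus_aut_torus (rho : 'rV[R[i]]_n -> 'rV[R[i]]_n) u :
  torus_aut rho -> torus R n u -> torus R n (rho u).
Proof. by move=> [[rho' [_ h _ _ _]] _]; exact: h. Qed.

End TorusLemmas.

Section OrbitSpace.
Context {R : realType} {X : topologicalType} {n : nat} (A : weakly_standard_atlas R X n).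
Implicit Types a b c : idx A.

Definition chart_image a : set 'rV[R[i]]_n := A a @` dom (A a).

Definition pieces := {a : idx A & set_type (chart_image a)}.

HB.instance Definition _ := Topological.on pieces.

(* Quotients each chart image by the torus and glues along the overlaps in a
   single step: the orbits of [z] and [w] are identified when some [x] in the
   overlap is sent to [z] and to [w], up to the torus action. *)
Definition glued (p q : pieces) := exists x,
  [/\ dom (A (tag p)) x, dom (A (tag q)) x,
      same_orbit (A (tag p) x) (\val (tagged p)) &
      same_orbit (A (tag q) x) (\val (tagged q))].

Lemma chart_inj a x y : dom (A a) x -> dom (A a) y -> A a x = A a y -> x = y.
Proof.
have [_ _ _ [_ _ _ K _]] := atlas_chart a => dx dy e.
by rewrite -(K _ dx) e K.
Qed.

Lemma overlap_invariant a b x y : dom (A a) x -> dom (A b) x -> dom (A a) y ->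
  same_orbit (A a x) (A a y) ->
  dom (A b) y /\ same_orbit (A b x) (A b y).
Proof.
move=> ax bx ay [u tu yE].
have [|i1 i2 [rho arho eqv]] := @atlas_compatible _ _ _ A b a; first by exists x.
have := i2 _ (A a x) tu; rewrite -yE => -[|y' [by' ay'] /(chart_inj ay' ay) yy'].
  by exists x.
rewrite {}yy' in by' ay'; split=> //; exists (rho u).
  exact: torus_aut_torus.
have := eqv u (A a x) tu; rewrite -yE /transition /=.
have [_ _ _ [_ _ _ K _]] := atlas_chart a.
by rewrite !K //; apply; exists x.
Qed.

Lemma glued_refl p : glued p p.
Proof.
case: p => a [z za]; have [x ax xz] := set_mem za.
by exists x; split=> //=; rewrite xz; exact: same_orbit_refl.
Qed.

Lemma glued_sym p q : glued p q -> glued q p.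
Proof. by move=> [x [? ? ? ?]]; exists x. Qed.

Lemma glued_trans q p r : glued p q -> glued q r -> glued p r.
Proof.
move=> [x [px qx xp xq]] [y [qy ry yq yr]].
have /(overlap_invariant qy ry qx) [rx yx] :
    same_orbit (A (tag q) y) (A (tag q) x).
  exact: same_orbit_trans yq (same_orbit_sym xq).
exists x; split=> //.
exact: same_orbit_trans (same_orbit_sym yx) yr.
Qed.

Definition gluedb : rel pieces := fun p q => `[< glued p q >].

Lemma gluedb_refl : reflexive gluedb.
Proof. by move=> p; apply/asboolP; exact: glued_refl. Qed.

Lemma gluedb_sym : symmetric gluedb.
Proof. by move=> p q; apply/asboolP/asboolP; exact: glued_sym. Qed.

Lemma gluedb_trans : transitive gluedb.
Proof. by move=> q p r /asboolP pq /asboolP qr; apply/asboolP; exact: glued_trans qr. Qed.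

Canonical gluedb_equiv := EquivRel gluedb gluedb_refl gluedb_sym gluedb_trans.

Definition orbit_space := quotient_topology {eq_quot gluedb_equiv}.

HB.instance Definition _ := Topological.on orbit_space.

Definition orbit_of a (z : set_type (chart_image a)) : orbit_space :=
  \pi_orbit_space (existT _ a z : pieces).

Definition chart_pt a x (ax : dom (A a) x) : set_type (chart_image a) :=
  exist _ (A a x) (mem_set (imageP (A a) ax)).

(* Independent of the chosen chart around [x]; see [orbit_mapE]. *)
Definition orbit_map x : orbit_space :=
  let: exist a ax := cid (atlas_cover A x) in orbit_of (chart_pt ax).

Lemma orbit_ofP a b z w :
  @orbit_of a z = @orbit_of b w <-> glued (existT _ a z) (existT _ b w).
Proof. by split=> [/eqmodP/asboolP|zw]//; apply/eqmodP/asboolP. Qed.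

Lemma orbit_mapE a x (ax : dom (A a) x) : orbit_map x = orbit_of (chart_pt ax).
Proof.
rewrite /orbit_map; case: cid => b bx; apply/orbit_ofP.
by exists x; split=> //=; exact: same_orbit_refl.
Qed.

Lemma orbit_of_continuous a : continuous (@orbit_of a).
Proof.
by move=> z; apply: continuous_comp; [exact: existT_continuous|exact: pi_continuous].
Qed.

Lemma orbit_map_continuous : continuous orbit_map.
Proof.
move=> x O; rewrite nbhs_simpl /=.
have [a ax] := atlas_cover A x; rewrite (orbit_mapE ax).
move=> /orbit_of_continuous; rewrite nbhs_simpl /=.
move=> [_ [[W oW <-] /= Wx WO]].
have [oa _ _ [[cf _] _ _ _ _]] := atlas_chart a.
have cfx : {for x, continuous (A a)}.
  by have := cf; rewrite continuous_open_subspace // => /(_ x); apply; exact/mem_set.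
have /cfx W' : nbhs (A a x) W by exact: open_nbhs_nbhs.
have Ua : nbhs x (dom (A a)) by exact: open_nbhs_nbhs.
rewrite nbhs_simpl /= in W'.
apply: filterS (filterI W' Ua) => y [Wy ay] /=.
by rewrite (orbit_mapE ay); exact: WO.
Qed.

Definition orbit_chart_dom a : set orbit_space := range (@orbit_of a).

(* The map to the nonnegative orthant induced by [moment] on the orbits of the
   image of the chart [a]; see [orbit_chartE]. *)
Definition orbit_chart a (b : orbit_space) : 'rV[R]_n :=
  moment (xget 0 [set z | exists h : z \in chart_image a,
                            b = orbit_of (exist _ z h)]).

(* By equivariance of the transition maps, the number of nonzero coordinates
   does not depend on the chart. *)
Definition stratum (k : nat) : set orbit_space :=
  [set b | exists2 a, orbit_chart_dom a b &
             #|[set j | orbit_chart a b 0 j != 0]%SET| = k].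

Lemma moment_orbit (z w : 'rV[R[i]]_n) : same_orbit z w -> moment z = moment w.
Proof.
by move=> [u tu ->]; apply/rowP => j; rewrite !mxE normrM tu mul1r.
Qed.

Definition orbit_section (s : orbit_space -> X) :=
  continuous s /\ forall b : orbit_space, orbit_map (s b) = b.

End OrbitSpace.
Arguments stratum {R X n} A k.

(* The canonical model over [orbit_chart_dom a] consists of the pairs [(b, z)]
   with [moment z = orbit_chart a b]. Its fiber over [b] is the torus orbit of
   the point [fiber_one] with nonnegative real coordinates, that is, the quotient
   of the torus by the stabilizer of that point, hence an abelian group. Where
   [z 0 j = 0] the convention [0^-1 = 0] gives [fiber_mul] the expected value. *)
Section FiberGroup.
Context {R : realType} {n : nat}.
Implicit Types (u v z w : 'rV[R[i]]_n) (xi : 'rV[R]_n).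

Definition fiber_one xi : 'rV[R[i]]_n := \row_j (Num.sqrt (xi 0 j))%:C.

Definition fiber_mul z w : 'rV[R[i]]_n := \row_j (z 0 j * w 0 j / `|z 0 j|).

Definition fiber_inv z : 'rV[R[i]]_n := \row_j (z 0 j)^*.

Definition phase z : 'rV[R[i]]_n :=
  \row_j (if z 0 j == 0 then 1 else z 0 j / `|z 0 j|).

Lemma torus_phase z : torus R n (phase z).
Proof.
move=> j; rewrite mxE; case: eqVneq => [_|z0]; first exact: normr1.
by rewrite normrM normfV normr_id divff // normr_eq0.
Qed.

Lemma fiber_oneE z : fiber_one (moment z) = \row_j `|z 0 j|.
Proof.
apply/rowP => j; rewrite !mxE normc_def -rmorphXn /= sqr_sqrtr //.
by rewrite addr_ge0 // sqr_ge0.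
Qed.

Lemma fiber_phase z : z = tact (phase z) (fiber_one (moment z)).
Proof.
rewrite fiber_oneE; apply/rowP => j; rewrite !mxE.
by case: eqVneq => [->|z0]; rewrite ?normr0 ?mulr0 // divfK // normr_eq0.
Qed.

Lemma moment_same_orbit z w : moment z = moment w -> same_orbit z w.
Proof.
move=> zw; exists (tact (phase w) (tinv (phase z))).
  by apply: torusM; [|apply: torusV]; exact: torus_phase.
rewrite -tactA {2}(fiber_phase z) tactK; last exact: torus_phase.
by rewrite zw -fiber_phase.
Qed.

Lemma moment_fiber_one z : moment (fiber_one (moment z)) = moment z.
Proof. by rewrite fiber_oneE; apply/rowP => j; rewrite !mxE normr_id. Qed.

Lemma same_orbit_fiber_one z : same_orbit z (fiber_one (moment z)).
Proof. by apply: moment_same_orbit; rewrite moment_fiber_one. Qed.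

Lemma fiber_mul_inv z t : torus R n t ->
  fiber_mul z (fiber_inv (tact t (fiber_one (moment z)))) = tact (tinv t) z.
Proof.
move=> tt; rewrite fiber_oneE; apply/rowP => j; rewrite !mxE.
have t0 : t 0 j != 0 by rewrite -normr_eq0 tt oner_neq0.
have tV : (t 0 j)^* = (t 0 j)^-1.
  apply: (mulfI t0); rewrite divff //.
  by have := sqr_normc (t 0 j); rewrite tt expr1n => <-.
have -> : (t 0 j * `|z 0 j|)^* = (t 0 j)^-1 * `|z 0 j|.
  by rewrite -tV normc_def -[in RHS]conjc_real; exact: rmorphM.
case: (eqVneq (z 0 j) 0) => [->|z0]; first by rewrite !(mul0r, mulr0).
by rewrite mulrA mulfK ?normr_eq0 // mulrC.
Qed.

End FiberGroup.

Section EulerClass.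
Context {R : realType} {X : topologicalType} {n : nat} (A : weakly_standard_atlas R X n).
Implicit Types (a c : idx A) (b : orbit_space A).

(* The automorphism attached to the transition map between the charts [c] and
   [a]; irrelevant if the charts do not overlap. *)
Definition overlap_aut a c : 'rV[R[i]]_n -> 'rV[R[i]]_n :=
  if pselect (exists rho, torus_aut rho /\
      tequivariant rho (A c @` overlap (A a) (A c)) (transition (A a) (A c)))
  is left h then sval (cid h) else id.

(* The zero section of the canonical model in the chart [a], and the transition
   map of the canonical model from the chart [c] to the chart [a]: it covers the
   same map of orbit spaces as [transition (A a) (A c)], is equivariant for the
   same automorphism, and maps the zero section to the zero section. *)
Definition model_zero a b := fiber_one (orbit_chart a b).

Definition model_transition a c b (w : 'rV[R[i]]_n) :=
  tact (overlap_aut a c (phase w)) (model_zero a b).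

(* Comparing [X] with its canonical model through the charts, the two transition
   maps differ by the multiplication by this section of the canonical model
   over the overlap. The Euler class is the class of this cocycle in the first
   Cech cohomology of the orbit space with coefficients in the sheaf of
   continuous sections of the canonical model. *)
Definition euler_cocycle a c b :=
  transition (A a) (A c) (model_zero c b).

(* The cocycle becomes the coboundary of a continuous cochain [s] on an open
   cover [V] which refines, via [tau], the cover by the [orbit_chart_dom a]. *)
Definition euler_class_vanishes :=
  exists (K : Type) (V : K -> set (orbit_space A)) (tau : K -> idx A)
         (s : K -> orbit_space A -> 'rV[R[i]]_n),
  [/\ forall k, open (V k) /\ V k `<=` orbit_chart_dom (tau k),
      forall b, exists k, V k b,
      forall k, {within V k, continuous s k},
      forall k b, V k b -> moment (s k b) = orbit_chart (tau k) b &
      forall k l b, V k b -> V l b ->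
        euler_cocycle (tau k) (tau l) b =
        fiber_mul (s k b)
          (fiber_inv (model_transition (tau k) (tau l) b (s l b)))].

Lemma overlap_autP a c : overlap (A a) (A c) !=set0 ->
  torus_aut (overlap_aut a c) /\
  tequivariant (overlap_aut a c) (A c @` overlap (A a) (A c))
    (transition (A a) (A c)).
Proof.
move=> /atlas_compatible[_ _ [rho ? ?]].
rewrite /overlap_aut; case: pselect => [h|[]]; first by case: cid.
by exists rho.
Qed.

Lemma orbit_mapP a x y : dom (A a) x ->
  (orbit_map A y = orbit_map A x) <-> dom (A a) y /\ same_orbit (A a x) (A a y).
Proof.
move=> ax; have [c cy] := atlas_cover A y.
rewrite (orbit_mapE ax) (orbit_mapE cy); split.
  move=> /orbit_ofP[t /= [ct at_ cty atx]].
  have [ay aty] := overlap_invariant ct at_ cy cty.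
  by split=> //; exact: same_orbit_trans (same_orbit_sym atx) aty.
move=> [ay xy]; apply/orbit_ofP; exists y; split=> //=.
  exact: same_orbit_refl.
exact: same_orbit_sym.
Qed.

Lemma orbit_chart_domP a b :
  orbit_chart_dom a b <-> exists2 x, dom (A a) x & b = orbit_map A x.
Proof.
split=> [[[z za] _ <-]|[x ax ->]]; last by exists (chart_pt ax); rewrite // -orbit_mapE.
have [x ax xz] := set_mem za; exists x => //; rewrite (orbit_mapE ax).
by apply/orbit_ofP; exists x; split=> //=; rewrite ?xz; exact: same_orbit_refl.
Qed.

Lemma orbit_chart_dom_map a x : orbit_chart_dom a (orbit_map A x) <-> dom (A a) x.
Proof.
split=> [/orbit_chart_domP[y ay /(orbit_mapP _ ay)[]//]|ax].
by apply/orbit_chart_domP; exists x.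
Qed.

Lemma orbit_chartE a x : dom (A a) x ->
  orbit_chart a (orbit_map A x) = moment (A a x).
Proof.
move=> ax; rewrite /orbit_chart; case: xgetP => [z _ [za]|].
  have [y ay yz] := set_mem za.
  rewrite (orbit_mapE ax) => /orbit_ofP[t /= [at_ _ tx tz]].
  by rewrite -(moment_orbit tz) (moment_orbit tx).
move=> /(_ (A a x)) /=; case.
by exists (mem_set (imageP (A a) ax)); rewrite (orbit_mapE ax).
Qed.

Lemma orbit_chart_dom_open a : open (orbit_chart_dom a).
Proof.
rewrite /open /= /quotient_open; apply/sigT_openP => c.
have [oc oci ic [[cf cg] fB gA K1 K2]] := atlas_chart c.
rewrite openE => -[z zc] /= zac.
have [x cx xz] := set_mem zc.
have ax : dom (A a) x.
  apply/orbit_chart_dom_map; rewrite (orbit_mapE cx).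
  rewrite (_ : orbit_of _ = orbit_of (exist _ z zc)) //.
  apply/orbit_ofP; exists x; split=> //=; first exact: same_orbit_refl.
  by rewrite xz; exact: same_orbit_refl.
have [oa _ _ _] := atlas_chart a.
have zim : (A c @` dom (A c)) z by exists x.
have : {for z, continuous (chart_inv (A c))}.
  by have := cg; rewrite continuous_open_subspace // => /(_ z); apply; exact/mem_set.
move=> /(_ (dom (A a))); rewrite -{1}xz K1 // => /(_ (open_nbhs_nbhs (conj oa ax))).
rewrite nbhs_simpl /= nbhsE => -[W [oW Wz] WO].
have oV : open ((set_val : chart_image c -> 'rV[R[i]]_n) @^-1` W) by exists W.
apply: (@filterS _ _ _ ((set_val : chart_image c -> 'rV[R[i]]_n) @^-1` W)).
  2: by apply: open_nbhs_nbhs; split.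
move=> [w wc] /= Ww.
have [y cy yw] := set_mem wc.
have ay : dom (A a) y by have := WO w Ww; rewrite /= -yw K1.
apply/orbit_chart_domP; exists y => //; rewrite (orbit_mapE cy).
apply/orbit_ofP; exists y; split=> //=; rewrite ?yw; exact: same_orbit_refl.
Qed.

Lemma chart_image_orbit a x (z : 'rV[R[i]]_n) : dom (A a) x ->
  same_orbit (A a x) z ->
  [/\ dom (A a) (chart_inv (A a) z), A a (chart_inv (A a) z) = z &
      orbit_map A (chart_inv (A a) z) = orbit_map A x].
Proof.
move=> ax [u tu zE]; have [_ _ inv_a [_ _ gA K1 K2]] := atlas_chart a.
have za : (A a @` dom (A a)) z by rewrite zE; apply: inv_a => //; exists x.
split; [exact: gA|exact: K2|].
by apply/(orbit_mapP _ ax); split; [exact: gA|rewrite K2 //; exists u].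
Qed.

Lemma euler_cocycleE a c x y : dom (A a) x -> dom (A a) y -> dom (A c) y ->
  orbit_map A x = orbit_map A y ->
  (euler_cocycle a c (orbit_map A x) =
   fiber_mul (A a x)
     (fiber_inv (model_transition a c (orbit_map A x) (A c y)))) <-> x = y.
Proof.
move=> ax ay cy xy.
have ac : overlap (A a) (A c) !=set0 by exists y.
have [arho eqv] := overlap_autP ac.
have tv := torus_phase (A c y).
have trho := torus_aut_torus arho tv.
have cx : dom (A c) x by move: xy => /(orbit_mapP _ cy) [].
rewrite /model_transition /model_zero (orbit_chartE ax) fiber_mul_inv //.
rewrite /euler_cocycle /model_zero {1}xy orbit_chartE //.
have [z0c z0E z0o] := chart_image_orbit cy (same_orbit_fiber_one (A c y)).
have [z0a _] : dom (A a) (chart_inv (A c) (fiber_one (moment (A c y)))) /\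
    same_orbit (A a y) (A a (chart_inv (A c) (fiber_one (moment (A c y))))).
  exact/(orbit_mapP _ ay).
have key : A a y = tact (overlap_aut a c (phase (A c y)))
    (transition (A a) (A c) (fiber_one (moment (A c y)))).
  rewrite -eqv //; last first.
    by exists (chart_inv (A c) (fiber_one (moment (A c y)))).
  rewrite -fiber_phase /transition /=.
  by have [_ _ _ [_ _ _ K _]] := atlas_chart c; rewrite K.
split=> [h|->]; last by rewrite key tactK.
apply: (chart_inj ax ay); rewrite key h tactA (tactC _ (tinv _)) -tactA tactK //.
Qed.

Lemma euler_class_vanishesP :
  euler_class_vanishes <-> exists s, orbit_section (A := A) s.
Proof.
split=> [[K [V [tau [s [oV cV cs ms es]]]]]|[s [cs sK]]].
  pose y k b := chart_inv (A (tau k)) (s k b).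
  have yP k b : V k b ->
      [/\ dom (A (tau k)) (y k b), A (tau k) (y k b) = s k b &
          orbit_map A (y k b) = b].
    move=> kb; have /orbit_chart_domP[x ax bE] := (oV k).2 _ kb.
    have mE : moment (A (tau k) x) = moment (s k b).
      by rewrite ms // bE orbit_chartE.
    have [? ? h] := chart_image_orbit ax (moment_same_orbit mE).
    by split=> //; rewrite h.
  have yE k l b : V k b -> V l b -> y k b = y l b.
    move=> kb lb; have [dk sk ok] := yP _ _ kb; have [dl sl ol] := yP _ _ lb.
    have dkl : dom (A (tau k)) (y l b).
      by apply/orbit_chart_dom_map; rewrite ol; exact: (oV k).2.
    apply/(euler_cocycleE dk dkl dl); first by rewrite ok ol.
    by rewrite ok sk sl; exact: es.
  pose sg b := y (projT1 (cid (cV b))) b.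
  have sgE k b : V k b -> sg b = y k b.
    by move=> kb; rewrite /sg; case: cid => l lb /=; exact: yE.
  exists sg; split=> [b|b]; last first.
    by have [k kb] := cV b; rewrite (sgE _ _ kb); have [] := yP _ _ kb.
  have [k kb] := cV b.
  have cy : {within V k, continuous (y k)}.
    have [_ _ _ [[_ cg] _ _ _ _]] := atlas_chart (tau k).
    apply: (within_comp (g := chart_inv (A (tau k))) (cs k) cg) => b' kb'.
    by have [d e _] := yP _ _ kb'; exists (y k b').
  have cyb : {for b, continuous (y k)}.
    have := cy; rewrite continuous_open_subspace; last exact: (oV k).1.
    by move=> /(_ b); apply; exact/mem_set.
  rewrite /continuous_at (sgE _ _ kb) => W /cyb; rewrite !nbhs_simpl /= => yW.
  have Vb : nbhs b (V k) by apply: open_nbhs_nbhs; split=> //; exact: (oV k).1.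
  by apply: filterS (filterI yW Vb) => b' [Wb' kb'] /=; rewrite (sgE _ _ kb').
have ds a b : orbit_chart_dom a b -> dom (A a) (s b).
  by move=> ab; apply/orbit_chart_dom_map; rewrite sK.
exists (idx A), (@orbit_chart_dom _ _ _ A), id, (fun a b => A a (s b)); split.
- by move=> a; split=> //; exact: orbit_chart_dom_open.
- move=> b; have [a ab] := atlas_cover A (s b).
  by exists a; rewrite -(sK b); apply/orbit_chart_dom_map.
- move=> a; have [_ _ _ [[cf _] _ _ _ _]] := atlas_chart a.
  apply: (within_comp (g := A a) (f := s) _ cf) => [|b /ds//].
  exact: continuous_subspaceT.
- by move=> a b ab; rewrite -orbit_chartE ?sK //; exact: ds.
- move=> a c b ab cb; rewrite -{1 3}(sK b).
  by apply/euler_cocycleE => //; exact: ds.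
Qed.

End EulerClass.
Arguments euler_class_vanishes {R X n} A.

(* Main.v *)
From mathcomp Require Import all_boot all_order all_algebra ring lra complex.
From mathcomp Require Import all_classical all_reals all_analysis.
Require Import Defs.

(** Only two features of the orbit map [mu : X -> B] matter once it has a
    section [s]: its fibers are path connected, and every point of [X] has a
    neighborhood [N], a union of fibers, such that every loop in [N] is
    contractible in [X]. They imply that [mu] is an isomorphism on fundamental
    groups ([pi1_map_isomorphism]):

    - Surjectivity: the base point is joined to the section by a path in its
      fiber, and the conjugate by this path of the image under [s] of a loop
      [beta] is a lift of [beta], up to reparametrization.

    - Injectivity: every loop [a] is freely homotopic to [s \o mu \o a]
      ([path_to_section]). Indeed, cut [0, 1] into intervals which [a] sends
      into neighborhoods [N] as above, and join [a t] to [s (mu (a t))] by a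
      path in the fiber at every cutting point. Over each interval, the four
      sides of the square to be filled form a loop in [N], hence the square can
      be filled. If [mu \o a] is null homotopic, then [a] is freely homotopic to
      a constant, thus also null homotopic relatively to the base point.

    The fibers are quotients of the torus, thus path connected. For the
    neighborhoods, a chart identifies the fiber of a point [x] with the torus
    orbit of some [z] in the space of complex row vectors. Take for [N] the set
    of the [w] whose coordinates have moduli close to those of [z]: it is a
    product of annuli (where [z] has a nonzero coordinate) and of discs (where
    it has a zero). Let [v] be any other point of [N]. Moving the coordinates in
    annuli along their rays, and those in discs along segments, deforms [N] into
    the orbit of [v] ([radial]). As a consequence, if all loops in just one
    fiber of [N] contract in [X], so do all loops in [N], in particular those in
    the other fibers. Hence the set of points of [X] whose fiber has this
    property is open and closed; it contains the points over a vertex, whose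
    fibers are single points, so it is all of [X] by connectedness
    ([orbit_nbhs_fillable]).

    Contractibility of loops is expressed by extending maps from the boundary
    of the square to the whole square ([fillable]), which avoids base points. *)

Set Implicit Arguments.
Unset Strict Implicit.
Unset Printing Implicit Defensive.

Import Order.TTheory GRing.Theory Num.Theory.
Import numFieldNormedType.Exports.

Local Open Scope classical_set_scope.
Local Open Scope ring_scope.
Local Open Scope complex_scope.

(** * Filling maps from the boundary of a square *)

Lemma within_pair (S T U : topologicalType) (A : set S) (f : S -> T) (g : S -> U) :
  {within A, continuous f} -> {within A, continuous g} ->
  {within A, continuous (fun z => (f z, g z))}.
Proof. by move=> cf cg z; apply: cvg_pair; [exact: cf|exact: cg]. Qed.

Section Filling.
Context {R : realType} {X : topologicalType}.
Local Notation I01 := (`[0, 1]%classic : set R).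

(** For the sup norm of the plane the unit sphere is the boundary of a square. *)
Definition circ : set (R * R) := [set q | `|q| = 1].
Definition disc : set (R * R) := [set q | `|q| <= 1].

(** Every loop in [S] is contractible in the ambient space [X], not necessarily
    in [S]. *)
Definition fillable (S : set X) := forall f : R * R -> X,
  {within circ, continuous f} -> (forall q, circ q -> S (f q)) ->
  exists2 F : R * R -> X, {within disc, continuous F} &
    forall q, circ q -> F q = f q.

Lemma fillableS (S T : set X) : S `<=` T -> fillable T -> fillable S.
Proof. by move=> ST fT f cf Sf; apply: fT => // q /Sf /ST. Qed.

Lemma cont_norm_plane : continuous (fun q : R * R => `|q|).
Proof. by move=> q; exact: norm_continuous. Qed.

Lemma closed_disc : closed disc.
Proof.
rewrite (_ : disc = (fun q : R * R => `|q|) @^-1` [set r | r <= 1]) //.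
by apply: preimage_closed => [z _|]; [exact: cont_norm_plane|exact: closed_le].
Qed.

(** Contractibility of a loop only depends on its free homotopy class: the
    inner half of the square is filled by the extension of the last loop, and
    the homotopy is laid along the rays of the outer half. *)
Lemma fillable_homotopy (S : set X) (h : R * (R * R) -> X) :
  fillable S -> {within I01 `*` circ, continuous h} ->
  (forall q, circ q -> S (h (1, q))) ->
  exists2 F : R * R -> X, {within disc, continuous F} &
    forall q, circ q -> F q = h (0, q).
Proof.
move=> fS ch Sh.
have ch1 : {within circ, continuous (fun q => h (1, q))}.
  apply: (within_comp (B := I01 `*` circ) (f := fun q : R * R => (1 : R, q)) _ ch).
    by apply: continuous_subspaceT; apply: cont_pair => z //; exact: cvg_cst.
  by move=> q cq; split=> //; exact: I1.
have [G cG GE] := fS _ ch1 Sh.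
have nc := cont_norm_plane.
exists (fun q => if `|q| <= 2^-1 then G (2 *: q)
                 else h (2 - 2 * `|q|, `|q|^-1 *: q)); last first.
  move=> q q1; rewrite q1; case: ifPn => [|_]; first by move=> ?; exfalso; lra.
  by rewrite mulr1 subrr invr1 scale1r.
apply: (paste_within closed_disc nc).
- apply: (within_comp (f := fun q : R * R => 2 *: q) _ cG).
    by apply: continuous_subspaceT => z; apply: cvgZ; [exact: cvg_cst|].
  by move=> q [_ /= hq]; rewrite /disc /= normrZ ger0_norm //; lra.
- apply: (within_comp (f := fun q : R * R => (2 - 2 * `|q|, `|q|^-1 *: q)) _ ch).
    apply: within_pair.
      apply: continuous_subspaceT => z; apply: cvgB; first exact: cvg_cst.
      by apply: cvgM; [exact: cvg_cst|exact: nc].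
    apply/subspace_continuousP => q [_ /= hq].
    apply: cvg_within_filter; apply: cvgZ => //; apply: cvgV; last exact: nc.
    by apply/eqP => q0; move: hq; rewrite q0; lra.
  move=> q [/= dq hq]; have q0 : `|q| != 0 by apply/eqP => q0; move: hq; rewrite q0; lra.
  split=> /=; first by move: dq; rewrite /disc /= in_itv /=; lra.
  by rewrite /circ /= normrZ normfV normr_id mulVf.
- move=> q _ hq; rewrite hq mulfV // invrK (_ : 2 - 1 = 1); last by lra.
  by rewrite GE // /circ /= normrZ hq ger0_norm // mulfV.
Qed.

Lemma circE p q : circ (p, q) <->
  [/\ -1 <= p <= 1, -1 <= q <= 1 & [\/ q = -1, q = 1, p = -1 | p = 1]].
Proof.
rewrite /circ /= prod_normE /=; split.
  have := ler_norm p; have := ler_norm (- p); have := ler_norm q.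
  have := ler_norm (- q); rewrite !normrN => h1 h2 h3 h4 h.
  have hp : `|p| <= 1 by rewrite -h le_max lexx.
  have hq : `|q| <= 1 by rewrite -h le_max lexx orbT.
  split; [by lra|by lra|].
  move: h; rewrite /Num.max; case: ifP => _.
    by case: (ger0P q) => _ ?; [apply: Or42|apply: Or41]; lra.
  by case: (ger0P p) => _ ?; [apply: Or44|apply: Or43]; lra.
move=> [hp hq hpq]; apply/eqP; rewrite eq_le; apply/andP; split.
  by rewrite ge_max !ler_norml; apply/andP.
by rewrite le_max; case: hpq => ->; rewrite ?normrN normr1 lexx ?orbT.
Qed.

Lemma discE p q : disc (p, q) <-> -1 <= p <= 1 /\ -1 <= q <= 1.
Proof.
rewrite /disc /= prod_normE /= ge_max !ler_norml.
by split=> [/andP|[-> ->]].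
Qed.

(** The form of [fillable] which is used to build homotopies: four paths which
    agree at the corners form a loop. *)
Lemma fill_rectangle (S : set X) (t1 t2 : R) (a b c d : R -> X) :
  fillable S -> t1 < t2 ->
  {within `[t1, t2], continuous a} -> {within `[t1, t2], continuous b} ->
  {within I01, continuous c} -> {within I01, continuous d} ->
  (forall t, t1 <= t <= t2 -> S (a t) /\ S (b t)) ->
  (forall t, I01 t -> S (c t) /\ S (d t)) ->
  c 0 = a t1 -> c 1 = b t1 -> d 0 = a t2 -> d 1 = b t2 ->
  exists K : R * R -> X,
    {within `[t1, t2] `*` I01, continuous K} /\
    [/\ forall t, t1 <= t <= t2 -> K (t, 0) = a t,
        forall t, t1 <= t <= t2 -> K (t, 1) = b t,
        forall s, I01 s -> K (t1, s) = c s &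
        forall s, I01 s -> K (t2, s) = d s].
Proof.
move=> fS t12 ca cb cc cd Sab Scd c0 c1 d0 d1.
pose tau p := (t2 - t1) / 2 * p + (t1 + t2) / 2.
pose sig q : R := 2^-1 * q + 2^-1.
have taui p : -1 <= p <= 1 -> t1 <= tau p <= t2 by rewrite /tau; nra.
have sigi q : -1 <= q <= 1 -> I01 (sig q) by rewrite /sig /= in_itv /=; lra.
have tauN : tau (-1) = t1 by rewrite /tau; lra.
have tau1 : tau 1 = t2 by rewrite /tau; lra.
have sigN : sig (-1) = 0 by rewrite /sig; lra.
have sig1 : sig 1 = 1 by rewrite /sig; lra.
have ctau : continuous (fun z : R * R => tau z.1) by apply: cont_affine; exact: cont_fst.
have csig : continuous (fun z : R * R => sig z.2) by apply: cont_affine; exact: cont_snd.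
(* The corners, where two sides compete, are irrelevant by compatibility. *)
pose f (z : R * R) := if z.2 == -1 then a (tau z.1) else if z.2 == 1 then b (tau z.1)
  else if z.1 == -1 then c (sig z.2) else d (sig z.2).
have N11 : ((-1 : R) == 1) = false by apply/eqP; lra.
have N1N : ((1 : R) == -1) = false by apply/eqP; lra.
have fa p : f (p, -1) = a (tau p) by rewrite /f /= eqxx.
have fb p : f (p, 1) = b (tau p) by rewrite /f /= N1N eqxx.
have fc q : f (-1, q) = c (sig q).
  rewrite /f /= eqxx; case: eqVneq => [->|_]; first by rewrite tauN sigN.
  by case: eqVneq => [->|_] //; rewrite tauN sig1.
have fd q : f (1, q) = d (sig q).
  rewrite /f /= N1N; case: eqVneq => [->|_]; first by rewrite tau1 sigN.
  by case: eqVneq => [->|_] //; rewrite tau1 sig1.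
have Sf z : circ z -> S (f z).
  case: z => p q /circE[hp hq [] hpq]; rewrite hpq.
  - by rewrite fa; apply: (Sab _ _).1; exact: taui.
  - by rewrite fb; apply: (Sab _ _).2; exact: taui.
  - by rewrite fc; apply: (Scd _ _).1; exact: sigi.
  - by rewrite fd; apply: (Scd _ _).2; exact: sigi.
pose side (g : R * R -> R) (e : R) : set (R * R) := disc `&` [set z | g z = e].
have cside g e : continuous g -> closed (side g e).
  move=> cg; apply: closedI; first exact: closed_disc.
  by apply: (@preimage_closed _ _ g [set e]) => [z _|]; [exact: cg|exact: closed_eq].
have circU : circ = side snd (-1) `|` side snd 1 `|` side fst (-1) `|` side fst 1.
  apply/seteqP; split=> -[p q].
    move=> /circE[hp hq hpq]; have dpq : disc (p, q) by apply/discE.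
    by case: hpq => e; [do 3 left|do 2 left; right|left; right|right]; split.
  by move=> [[[]|]|] [/discE[hp hq] /= e]; apply/circE; split=> //; rewrite e;
    [apply: Or41|apply: Or42|apply: Or43|apply: Or44].
have cf : {within circ, continuous f}.
  rewrite circU; apply: withinU_continuous; [|exact/cside/cont_fst| |].
    by do ?apply: closedU; apply: cside; do ?[exact: cont_fst|exact: cont_snd].
  apply: withinU_continuous; [|exact/cside/cont_fst| |].
    by do ?apply: closedU; apply: cside; do ?[exact: cont_fst|exact: cont_snd].
  apply: withinU_continuous; [exact/cside/cont_snd|exact/cside/cont_snd| |].
  - apply: (@subspace_eq_continuous _ _ _ (a \o (fun z => tau z.1))).
      by move=> [p q]; rewrite inE /= => -[_ /= ->]; rewrite /from_subspace fa.
    apply: within_comp ca _; first exact: continuous_subspaceT.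
    by move=> [p q] [/discE[/taui h _] _]; rewrite /= in_itv.
  - apply: (@subspace_eq_continuous _ _ _ (b \o (fun z => tau z.1))).
      by move=> [p q]; rewrite inE /= => -[_ /= ->]; rewrite /from_subspace fb.
    apply: within_comp cb _; first exact: continuous_subspaceT.
    by move=> [p q] [/discE[/taui h _] _]; rewrite /= in_itv.
  - apply: (@subspace_eq_continuous _ _ _ (c \o (fun z => sig z.2))).
      by move=> [p q]; rewrite inE /= => -[_ /= ->]; rewrite /from_subspace fc.
    apply: within_comp cc _; first exact: continuous_subspaceT.
    by move=> [p q] [/discE[_ /sigi h] _].
  - apply: (@subspace_eq_continuous _ _ _ (d \o (fun z => sig z.2))).
      by move=> [p q]; rewrite inE /= => -[_ /= ->]; rewrite /from_subspace fd.
    apply: within_comp cd _; first exact: continuous_subspaceT.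
    by move=> [p q] [/discE[_ /sigi h] _].
(* The affine inverses of [tau] and [sig] transport the filling back. *)
have [F cF FE] := fS f cf Sf.
pose tau' t := 2 / (t2 - t1) * t - (t1 + t2) / (t2 - t1).
pose sig' s : R := 2 * s - 1.
have t21 : t2 - t1 != 0 by apply/eqP; lra.
have tau'K t : tau (tau' t) = t by rewrite /tau /tau'; field.
have sig'K s : sig (sig' s) = s by rewrite /sig /sig'; lra.
have tau'1 : tau' t1 = -1 by rewrite /tau'; field.
have tau'2 : tau' t2 = 1 by rewrite /tau'; field.
have tau'i t : t1 <= t <= t2 -> -1 <= tau' t <= 1.
  move=> ht; have := tau'K t; rewrite /tau => e; apply/andP; split; nra.
have sig'i s : I01 s -> -1 <= sig' s <= 1 by rewrite /sig' /= in_itv /=; lra.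
exists (fun z => F (tau' z.1, sig' z.2)); split.
  apply: (within_comp (f := fun z : R * R => (tau' z.1, sig' z.2)) _ cF).
    apply: continuous_subspaceT; apply: cont_pair; apply: cont_affine.
      exact: cont_fst.
    exact: cont_snd.
  move=> [t s] [/= + Is]; rewrite in_itv /= => ht.
  by apply/discE; split; [exact: tau'i|exact: sig'i].
have s0 : sig' 0 = -1 by rewrite /sig'; lra.
have s1 : sig' 1 = 1 by rewrite /sig'; lra.
split=> [t ht|t ht|s Is|s Is] /=.
- rewrite s0 FE ?fa ?tau'K //; apply/circE; split; [exact: tau'i|by lra|exact: Or41].
- rewrite s1 FE ?fb ?tau'K //; apply/circE; split; [exact: tau'i|by lra|exact: Or42].
- rewrite tau'1 FE ?fc ?sig'K //; apply/circE; split; [by lra|exact: sig'i|exact: Or43].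
- rewrite tau'2 FE ?fd ?sig'K //; apply/circE; split; [by lra|exact: sig'i|exact: Or44].
Qed.

End Filling.

(** * Homotopies of loops *)

Section FreeHomotopy.
Context {R : realType} {X : topologicalType}.
Local Notation I01 := (`[0, 1]%classic : set R).

Lemma half_lt1 : (1 <= 2^-1 :> R) = false.
Proof. by apply/negbTE; rewrite -ltNge; lra. Qed.

Definition clamp (u : R) : R := Num.min 1 (Num.max 0 u).

Lemma clampE u :
  clamp u = if u <= 0 then 0 else if u <= 1 then u else 1.
Proof.
have -> : clamp u = Num.min 1 (if u <= 0 then 0 else u).
  by rewrite /clamp /Num.max; case: ltP.
case: ifP => _; rewrite /Num.min; first by rewrite ltr10.
by case: ltP.
Qed.

Lemma cont_clamp (S : topologicalType) (f : S -> R) :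
  continuous f -> continuous (fun z => clamp (f z)).
Proof.
move=> cf z; apply: (@continuous_min _ _ (cst 1) (fun z => Num.max 0 (f z))).
  exact: cvg_cst.
by apply: (@continuous_max _ _ (cst 0) f); [exact: cvg_cst|exact: cf].
Qed.

Lemma cat_path_cont (p q : R -> X) :
  {within I01, continuous p} -> {within I01, continuous q} -> p 1 = q 0 ->
  {within I01, continuous (cat_fun p q)}.
Proof.
move=> cp cq pq.
apply: (paste_within (T := R) (h := id)) closed_I01 _ _ _ _ => [|||z _ ->].
- by move=> z.
- apply: (within_comp (f := fun t : R => 2 * t) _ cp).
    by apply: continuous_subspaceT; apply: cont_aff2 => z.
  by move=> t [/=]; rewrite !in_itv /=; lra.
- apply: (within_comp (f := fun t : R => 2 * t - 1) _ cq).
    by apply: continuous_subspaceT; apply: cont_affine => z.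
  by move=> t [/=]; rewrite !in_itv /=; lra.
- by rewrite mulfV // subrr.
Qed.

(** A free homotopy [L] to a constant moves the base point along the path
    [L (0, _)]. Deforming the bottom side of the square to the other three shows
    that [a] is homotopic to this path, run forwards and then backwards, and the
    latter retracts to its origin. *)
Lemma free_null_homotopic x (a : loop R x) (L : R * R -> X) y :
  {within I01 `*` I01, continuous L} ->
  (forall t, I01 t -> L (t, 0) = a t) -> (forall t, I01 t -> L (t, 1) = y) ->
  (forall r, I01 r -> L (0, r) = L (1, r)) -> homotopic a (loop_cst x).
Proof.
move=> cL L0 L1 Lr.
(* [(k t, m t)] runs through the left, top and right sides of the square. *)
pose k (t : R) := clamp (3 * t - 1).
pose m (t : R) := Num.min (clamp (3 * t)) (clamp (3 - 3 * t)).
have ck : continuous k by apply: cont_clamp; apply: cont_affine => z.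
have cm : continuous m.
  move=> t; suff h : {for t, continuous ((fun t : R => clamp (3 * t)) \min
    (fun t : R => clamp (3 - 3 * t)))} by exact: h.
  apply: continuous_min.
    by apply: cont_clamp => z; apply: cvgM => //; exact: cvg_cst.
  apply: cont_clamp => z; apply: cvgB; first exact: cvg_cst.
  by apply: cvgM => //; exact: cvg_cst.
have mE t : I01 t -> m t = if t <= 3^-1 then 3 * t else if t <= 2 / 3 then 1 else 3 - 3 * t.
  rewrite /= in_itv /m /= => It.
  have -> : clamp (3 * t) = if t <= 3^-1 then 3 * t else 1.
    by rewrite clampE; do ?[case: ifPn; rewrite -?ltNge -?leNgt => ?]; lra.
  have -> : clamp (3 - 3 * t) = if t <= 2 / 3 then 1 else 3 - 3 * t.
    by rewrite clampE; do ?[case: ifPn; rewrite -?ltNge -?leNgt => ?]; lra.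
  do ?[case: ifPn; rewrite -?ltNge -?leNgt => ?];
    by rewrite /Num.min; case: ltP => ?; lra.
have kE t : I01 t -> k t = if t <= 3^-1 then 0 else if t <= 2 / 3 then 3 * t - 1 else 1.
  rewrite /= in_itv /k /= !clampE => It.
  by do ?[case: ifPn; rewrite -?ltNge -?leNgt => ?]; lra.
have mI t : I01 t -> I01 (m t).
  move=> It; rewrite mE //; move: It; rewrite /= !in_itv /= => It.
  by do ?[case: ifPn; rewrite -?ltNge -?leNgt => ?]; lra.
have kI t : I01 t -> I01 (k t).
  move=> It; rewrite kE //; move: It; rewrite /= !in_itv /= => It.
  by do ?[case: ifPn; rewrite -?ltNge -?leNgt => ?]; lra.
have m0 : m 0 = 0 by rewrite mE; [case: ifPn; rewrite -?ltNge; lra|exact: I0].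
have m1 : m 1 = 0.
  by rewrite mE; [do ?[case: ifPn; rewrite -?ltNge -?leNgt => ?]; lra|exact: I1].
have k0 : k 0 = 0 by rewrite kE; [case: ifPn; rewrite -?ltNge; lra|exact: I0].
have k1 : k 1 = 1.
  by rewrite kE; [do ?[case: ifPn; rewrite -?ltNge -?leNgt => ?]; lra|exact: I1].
have L00 : L (0, 0) = x by rewrite L0 ?loop0 //; exact: I0.
have L10 : L (1, 0) = x by rewrite L0 ?loop1 //; exact: I1.
have cb : {within I01, continuous (fun t => L (k t, m t))}.
  apply: (within_comp (f := fun t => (k t, m t)) _ cL).
    by apply: continuous_subspaceT; exact: cont_pair.
  by move=> t It; split; [exact: kI|exact: mI].
have b0 : L (k 0, m 0) = x by rewrite k0 m0.
have b1 : L (k 1, m 1) = x by rewrite k1 m1.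
have bE t : I01 t -> L (k t, m t) = L (0, m t).
  move=> It; rewrite kE //; case: ifPn => // h1; case: ifPn => h2.
    have -> : m t = 1 by rewrite mE // ifF ?h2 //; exact/negbTE.
    rewrite !L1 //; first exact: I0.
    by move: h1 h2; rewrite /= in_itv /= -ltNge => ? ?; lra.
  by rewrite Lr //; exact: mI.
apply: (@homotopic_trans _ _ _ (Loop cb b0 b1)).
  exists (fun z => L ((1 - z.1) * z.2 + z.1 * k z.2, z.1 * m z.2)); split=> /=.
  - apply: (within_comp (f := fun z : R * R =>
      ((1 - z.1) * z.2 + z.1 * k z.2, z.1 * m z.2)) _ cL).
      apply: continuous_subspaceT; apply: cont_pair => z.
        apply: cvgD.
          by apply: cvgM; [apply: cvgB; [exact: cvg_cst|exact: cvg_fst]|exact: cvg_snd].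
        apply: cvgM; first exact: cvg_fst.
        by apply: (@cvg_comp _ _ _ snd k); [exact: cvg_snd|exact: ck].
      apply: cvgM; first exact: cvg_fst.
      by apply: (@cvg_comp _ _ _ snd m); [exact: cvg_snd|exact: cm].
    move=> [r t] [/= Ir It]; have := kI _ It; have := mI _ It; move: Ir It.
    by rewrite /= !in_itv /=; split; rewrite /= ?in_itv /=; nra.
  - by move=> t It; rewrite subr0 !mul0r mul1r addr0 L0.
  - by move=> t It; rewrite subrr mul0r !mul1r add0r.
  - by move=> r Ir; rewrite k0 k1 m0 m1 !mulr0 !mulr1 addr0 subrK L00 L10.
exists (fun z => L (0, (1 - z.1) * m z.2)); split=> /=.
- apply: (within_comp (f := fun z : R * R => (0 : R, (1 - z.1) * m z.2)) _ cL).
    apply: continuous_subspaceT; apply: cont_pair => z; first exact: cvg_cst.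
    apply: cvgM; first by apply: cvgB; [exact: cvg_cst|exact: cvg_fst].
    by apply: (@cvg_comp _ _ _ snd m); [exact: cvg_snd|exact: cm].
  move=> [r t] [/= Ir It]; have := mI _ It; move: Ir It.
  by rewrite /= !in_itv /=; split; rewrite /= ?in_itv /=; nra.
- by move=> t It; rewrite subr0 mul1r bE.
- by move=> t It; rewrite subrr mul0r.
- by move=> r Ir; rewrite m0 m1 mulr0.
Qed.

End FreeHomotopy.

(** * Maps with a section, connected fibers and locally contractible loops *)

(** Lebesgue's number lemma for the unit interval, in the form of an induction
    along the interval: a relation which holds between close points and can be
    chained holds between the ends. It is obtained by pushing a supremum. *)
Lemma interval_chain (R : realType) (P : R -> R -> Prop) :
  (forall t1 t2 t3, 0 <= t1 < t2 -> t2 < t3 <= 1 -> P t1 t2 -> P t2 t3 -> P t1 t3) ->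
  (forall t, 0 <= t <= 1 -> exists2 e, 0 < e & forall t1 t2,
     0 <= t1 < t2 -> t2 <= 1 -> t - e < t1 -> t2 < t + e -> P t1 t2) ->
  P 0 1.
Proof.
move=> Ptrans Ploc.
(* Requiring [P 0 t'] for all [t' <= t] makes [S] an interval. *)
pose S : set R := [set t | 0 < t <= 1 /\ forall t', 0 < t' <= t -> P 0 t'].
have [|e0 e0_gt0 P0] := Ploc 0; first by lra.
have Sm : S (Num.min (e0 / 2) 1).
  rewrite /S /= /Num.min; split; first by case: ifP => h; lra.
  move=> t'; case: ifP => h ht; apply: P0; lra.
have supS : has_sup S.
  by split; [exists (Num.min (e0 / 2) 1)|exists 1 => t [/andP[]]].
have c_gt0 : 0 < sup S by apply: lt_le_trans (sup_upper_bound supS Sm); case: Sm => /andP[].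
have c_le1 : sup S <= 1 by apply: ge_sup => [|t [/andP[]]//]; case: supS.
have [|e e_gt0 Pc] := Ploc (sup S); first by lra.
have [t1 [ht1 St1] t1c] := sup_adherent e_gt0 supS.
have t1_le : t1 <= sup S by apply: sup_upper_bound.
pose t2 := Num.min 1 (sup S + e / 2).
have t2_le1 : t2 <= 1 by rewrite /t2 ge_min lexx.
have t2_le : t2 <= sup S + e / 2 by rewrite /t2 ge_min lexx orbT.
have St2 : S t2.
  split; first by rewrite t2_le1 andbT /t2 /Num.min; case: ifP => _; lra.
  move=> t' ht'; have [le_t't1|lt_t1t'] := leP t' t1; first by apply: St1; lra.
  by apply: (Ptrans 0 t1 t'); [lra|lra|apply: St1; lra|apply: Pc; lra].
have : t2 <= sup S by exact: sup_upper_bound.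
have : S 1 -> P 0 1 by case=> _; apply; lra.
rewrite -{1}[1]/(1 : R) => S1; move: St2; rewrite /t2 /Num.min.
by case: ifP => h; [move=> /S1|lra].
Qed.

Section FiberedPi1.
Context {R : realType} {X B : topologicalType} (mu : X -> B) (s : B -> X).
Local Notation I01 := (`[0, 1]%classic : set R).
Hypotheses (mu_cont : continuous mu) (s_cont : continuous s) (sK : cancel s mu).

Definition fiber_path (x y : X) (p : R -> X) :=
  [/\ {within I01, continuous p}, p 0 = x, p 1 = y &
      forall t, I01 t -> mu (p t) = mu x].

Hypothesis fiber_connected :
  forall x y, mu x = mu y -> exists p, fiber_path x y p.
(** The section provides a lift of every loop based at [b], but this lift is
    based at [s b]; it is moved to [x] along a path [c] in the fiber, which
    becomes constant in [B]. *)
Lemma pi1_map_surjective x b (xb : mu x = b) (g : pi1 R b) :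
  exists h, pi1_map mu_cont xb h = g.
Proof.
rewrite -(pi1_classK g); set beta := repr g.
have [c [cc c0 c1 cmu]] : exists c, fiber_path x (s b) c.
  by apply: fiber_connected; rewrite sK.
pose rc t := c (1 - t).
have crc : {within I01, continuous rc}.
  apply: (within_comp (f := fun t : R => 1 - t) _ cc).
    by apply: continuous_subspaceT; apply: cont_aff1 => z.
  by move=> t /=; rewrite !in_itv /=; lra.
have csb : {within I01, continuous (s \o beta)}.
  apply: (within_comp (B := setT) (g := s) (loop_cont beta)) => //.
  exact: continuous_subspaceT.
have cq : {within I01, continuous (cat_fun (s \o beta) rc)}.
  by apply: cat_path_cont => //; rewrite /rc /= loop1 subr0 c1.
have cf : {within I01, continuous (cat_fun c (cat_fun (s \o beta) rc))}.
  apply: cat_path_cont => //.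
  by rewrite /cat_fun invr_ge0 ler0n mulr0 /= loop0.
have f0 : cat_fun c (cat_fun (s \o beta) rc) 0 = x.
  by rewrite /cat_fun invr_ge0 ler0n mulr0.
have f1 : cat_fun c (cat_fun (s \o beta) rc) 1 = x.
  rewrite /cat_fun mulr1 (_ : 2 - 1 = 1); last by lra.
  by rewrite half_lt1 mulr1 (_ : 2 - 1 = 1) ?half_lt1 /rc ?subrr //; lra.
exists (pi1_class (Loop cf f0 f1)); rewrite pi1_mapE; apply/pi1_classP.
(* The lift runs through [s \o beta] for [t] between [1/2] and [3/4]. *)
apply: (loop_id_aff (p := fun t => clamp (4 * t - 2))).
- by apply: cont_clamp; apply: cont_affine => z.
- move=> t _; rewrite clampE /= in_itv /=;
  by do ?[case: ifPn; rewrite -?ltNge -?leNgt => ?]; lra.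
- by rewrite clampE; do ?[case: ifPn; rewrite -?ltNge -?leNgt => ?]; lra.
- by rewrite clampE; do ?[case: ifPn; rewrite -?ltNge -?leNgt => ?]; lra.
- move=> t /=; rewrite in_itv /= => It; rewrite /cat_fun.
  case: ifPn; rewrite -?ltNge => h.
    rewrite cmu; last by rewrite /= in_itv /=; lra.
    by rewrite clampE ifT ?loop0 //; lra.
  case: ifPn; rewrite -?ltNge => h'.
    rewrite /= sK clampE ifF; last by apply/negbTE; rewrite -ltNge; lra.
    by rewrite ifT; [congr (beta _); lra|lra].
  rewrite /rc cmu; last by rewrite /= in_itv /=; lra.
  rewrite clampE ifF; last by apply/negbTE; rewrite -ltNge; lra.
  by rewrite ifF ?loop1 //; apply/negbTE; rewrite -ltNge; lra.
Qed.

Hypothesis locally_fillable : forall x : X, exists N : set X,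
  [/\ nbhs x N, fillable (R := R) N & forall y z, N y -> mu y = mu z -> N z].

(** The homotopy follows prescribed paths [c] and [d] in the fibers over the
    ends, so that for a loop [a] one can take [c = d] and get a free homotopy of
    loops. *)
Lemma path_to_section (a : R -> X) (c d : R -> X) :
  {within I01, continuous a} ->
  fiber_path (a 0) (s (mu (a 0))) c -> fiber_path (a 1) (s (mu (a 1))) d ->
  exists K : R * R -> X,
    {within I01 `*` I01, continuous K} /\
    [/\ forall t, I01 t -> K (t, 0) = a t,
        forall t, I01 t -> K (t, 1) = s (mu (a t)),
        forall r, I01 r -> K (0, r) = c r &
        forall r, I01 r -> K (1, r) = d r].
Proof.
move=> ca fc fd.
(* All fiber paths over the ends are allowed: this is what makes [P] chain. *)
pose P t1 t2 := forall c d : R -> X,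
  fiber_path (a t1) (s (mu (a t1))) c -> fiber_path (a t2) (s (mu (a t2))) d ->
  exists K : R * R -> X,
    {within `[t1, t2] `*` I01, continuous K} /\
    [/\ forall t, t1 <= t <= t2 -> K (t, 0) = a t,
        forall t, t1 <= t <= t2 -> K (t, 1) = s (mu (a t)),
        forall r, I01 r -> K (t1, r) = c r &
        forall r, I01 r -> K (t2, r) = d r].
suff P01 : P 0 1.
  have [K [cK [K0 K1 Kc Kd]]] := P01 c d fc fd.
  by exists K.
have csub t1 t2 : 0 <= t1 -> t2 <= 1 -> {within `[t1, t2], continuous a}.
  move=> ? ?; apply: continuous_subspaceW ca => t /=; rewrite !in_itv /=; lra.
have csec (D : set R) : {within D, continuous a} -> {within D, continuous (s \o mu \o a)}.
  move=> cD; apply: (within_comp (B := setT) (g := s \o mu) cD) => //.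
  apply: continuous_subspaceT => x.
  by apply: continuous_comp; [exact: mu_cont|exact: s_cont].
apply: interval_chain => [t1 t2 t3 h12 h23 P12 P23 c' d' fc' fd'|t It].
  have [m fm] : exists m, fiber_path (a t2) (s (mu (a t2))) m.
    by apply: fiber_connected; rewrite sK.
  have [F [cF [F0 F1 Fc Fd]]] := P12 _ _ fc' fm.
  have [G [cG [G0 G1 Gc Gd]]] := P23 _ _ fm fd'.
  (* [paste_within] pastes at the value [1/2], whence the shift. *)
  pose h (z : R * R) := z.1 + (2^-1 - t2).
  have ch : continuous h.
    move=> z; apply: cvgD; [exact: cvg_fst|exact: cvg_cst].
  exists (fun z => if h z <= 2^-1 then F z else G z); split.
    have clD : closed (`[t1, t3] `*` I01 : set (R * R)).
      rewrite (_ : _ `*` _ = (fst @^-1` `[t1, t3]) `&` (snd @^-1` I01)) //.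
      apply: closedI.
        apply: (@preimage_closed _ _ (fst : R * R -> R)) => [z _|]; first exact: cvg_fst.
        exact: interval_closed.
      apply: (@preimage_closed _ _ (snd : R * R -> R)) => [z _|]; first exact: cvg_snd.
      exact: interval_closed.
    apply: (paste_within clD ch).
    - apply: continuous_subspaceW cF => -[t r] [[/= + Ir]]; rewrite /h ?in_itv /= => ? ?.
      by split=> //=; rewrite ?in_itv /=; lra.
    - apply: continuous_subspaceW cG => -[t r] [[/= + Ir]]; rewrite /h ?in_itv /= => ? ?.
      by split=> //=; rewrite ?in_itv /=; lra.
    - move=> [t r] [/= _ Ir]; rewrite /h /= => ht.
      by rewrite (_ : t = t2) ?Fd ?Gc //; lra.
  split=> [t ht|t ht|r Ir|r Ir]; rewrite /h /=; case: ifPn; rewrite -?ltNge => ht'.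
  - by apply: F0; lra.
  - by apply: G0; lra.
  - by apply: F1; lra.
  - by apply: G1; lra.
  - exact: Fc.
  - by exfalso; lra.
  - by exfalso; lra.
  - exact: Gd.
have [N [nN fN satN]] := locally_fillable (a t).
have It' : I01 t by rewrite /= in_itv.
move/subspace_continuousP: (ca) => /(_ t It' N nN).
rewrite nbhs_simpl /= => /nbhs_ballP[e /= e_gt0 He].
exists e => // t1 t2 h12 t2_le1 et1 et2 c' d' [cc c0 c1 cmu] [cd d0 d1 dmu].
have Na t' : t1 <= t' <= t2 -> N (a t').
  move=> ht'; apply: He; last by rewrite /= in_itv /=; lra.
  by rewrite -ball_normE /= ltr_norml; lra.
have ca' : {within `[t1, t2], continuous a} by apply: csub; lra.
apply: (fill_rectangle (b := s \o mu \o a) fN) => //=; first by case/andP: h12.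
- exact: csec.
- move=> t' ht'; split; first exact: Na.
  by apply: satN (Na _ ht') _; rewrite sK.
- move=> r Ir; split.
    by apply: satN (Na t1 _) _; [lra|rewrite cmu].
  by apply: satN (Na t2 _) _; [lra|rewrite dmu].
Qed.
(** The homotopy from [a] to [s \o mu \o a] is followed by the image under [s]
    of the null homotopy of [mu \o a]. *)
Lemma loop_push_null x b (xb : mu x = b) (a : loop R x) :
  homotopic (loop_push mu_cont xb a) (loop_cst b) -> homotopic a (loop_cst x).
Proof.
move=> [H [cH H0 H1 Hb]].
have [c fc] : exists c, fiber_path x (s (mu x)) c.
  by apply: fiber_connected; rewrite sK.
have [||K [cK [K0 K1 Kc Kd]]] := path_to_section (c := c) (d := c) (loop_cont a).
- by rewrite loop0.
- by rewrite loop1.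
apply: (@free_null_homotopic _ _ _ _
  (fun z => if z.2 <= 2^-1 then K (z.1, 2 * z.2) else s (H (2 * z.2 - 1, z.1))) (s b)).
- apply: (paste_within (h := snd)) closed_square _ _ _ _.
  + exact: cont_snd.
  + apply: (within_comp (f := fun z : R * R => (z.1, 2 * z.2)) _ cK).
      apply: continuous_subspaceT; apply: cont_pair; first exact: cont_fst.
      exact/cont_aff2/cont_snd.
    by move=> [r t] [[/= Is It] ht]; split=> //=; move: It ht; rewrite ?in_itv /=; lra.
  + apply: (within_comp (B := setT) (g := s)) => //; last exact: continuous_subspaceT.
    apply: (within_comp (f := fun z : R * R => (2 * z.2 - 1, z.1)) _ cH).
      apply: continuous_subspaceT; apply: cont_pair; last exact: cont_fst.
      exact/cont_affine/cont_snd.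
    by move=> [r t] [[/= Is It] ht]; split=> //=; move: It ht; rewrite ?in_itv /=; lra.
  + by move=> [t r] [/= It _] ->; rewrite mulfV // subrr K1 // H0.
- by move=> t It /=; rewrite invr_ge0 ler0n mulr0 K0.
- move=> t It /=; rewrite half_lt1.
  by rewrite mulr1 (_ : 2 - 1 = 1) ?H1 //; lra.
- move=> r /=; rewrite in_itv /= => Ir; case: ifPn; rewrite -?ltNge => h.
    by rewrite Kc ?Kd //= in_itv /=; lra.
  by have [|-> ->] := Hb (2 * r - 1); rewrite //= in_itv /=; lra.
Qed.

Theorem pi1_map_isomorphism x b (xb : mu x = b) :
  group_isomorphism (pi1_map (R := R) mu_cont xb).
Proof.
split; first exact: pi1_mapM.
have map1 : pi1_map (R := R) mu_cont xb 1%g = 1%g.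
  have := pi1_mapM mu_cont xb (1%g : pi1 R x) 1%g.
  by rewrite mulg1 => /(congr1 (fun g => g * (pi1_map mu_cont xb 1%g)^-1)%g);
    rewrite mulgK mulgV.
have ker g : pi1_map (R := R) mu_cont xb g = 1%g -> g = 1%g.
  rewrite -{1 2}(pi1_classK g) pi1_mapE => /pi1_classP/loop_push_null h.
  exact/pi1_classP.
have inj : injective (pi1_map (R := R) mu_cont xb).
  move=> g h gh; have gh1 : (g * h^-1 = 1)%g.
    by apply: ker; rewrite pi1_mapM gh -pi1_mapM mulgV.
  by rewrite -[h]mul1g -gh1 -mulgA mulVg mulg1.
pose inv g := projT1 (cid (pi1_map_surjective xb g)).
have invK g : pi1_map mu_cont xb (inv g) = g by rewrite /inv; case: cid.
by exists inv => // g; apply: inj; rewrite invK.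
Qed.

End FiberedPi1.

(** * Topology of complex row vectors *)

Section ComplexTopology.
Context {R : realType}.
Local Notation C := (R[i]).
Local Notation normc := (@Normc.normc R).

Lemma normC_normc (c : C) : `|c| = (normc c)%:C.
Proof. by []. Qed.

Lemma normc_ge0 (c : C) : 0 <= normc c.
Proof. by rewrite -ler0c -normC_normc normr_ge0. Qed.

Lemma normc_eq0 (c : C) : (normc c == 0) = (c == 0).
Proof. by apply/eqP/eqP => [/Normc.eq0_normc//|->]; rewrite Normc.normc0. Qed.

Lemma normc_real (r : R) : normc r%:C = `|r|.
Proof. by rewrite /Normc.normc /= expr0n addr0 sqrtr_sqr. Qed.

Lemma cont_real_complex : continuous (fun r : R => r%:C : C).
Proof.
move=> r; apply/cvgrPdist_lt => e e0.
have [eI er] : e = (complex.Re e)%:C /\ 0 < complex.Re e.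
  by move: e0; case: e => a b; rewrite ltcE /= => /andP[/eqP-> a0].
have /cvgrPdist_lt/(_ _ er) : (fun r : R => r) r' @[r' --> r] --> r by [].
apply: filterS => r' h; rewrite -rmorphB eI normC_normc ltcR.
by rewrite normc_real.
Qed.

Lemma cvg_real_complex (T : Type) (F : set_system T) {FF : Filter F} (f : T -> R) (l : R) :
  f x @[x --> F] --> l -> (f x)%:C @[x --> F] --> (l%:C : C).
Proof. move=> fl; apply: (@cvg_comp _ _ _ f (fun r : R => r%:C : C) _ _ _ fl).
exact: cont_real_complex. Qed.

Lemma cont_normc : continuous normc.
Proof.
move=> c; apply/(cvgrPdist_lt (F := nbhs c)) => e e0.
have : nbhs c (ball c e%:C) by apply: nbhsx_ballx; rewrite ltcR.
apply: filterS => c'; rewrite -ball_normE /= => h.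
rewrite -ltcR; apply: le_lt_trans h.
have := ler_dist_dist c c'; rewrite !normC_normc -rmorphB.
by rewrite normc_real.
Qed.

(** Normalizing the segment from [1] to [c] fails for [c = -1]; normalizing the
    segment from [1] to a square root [v != -1] of [c] and squaring does not. *)
Lemma circle_path (c : C) : `|c| = 1 -> exists g : R -> C,
  [/\ {within `[0, 1], continuous g}, g 0 = 1, g 1 = c &
      forall t, 0 <= t <= 1 -> `|g t| = 1].
Proof.
move=> c1.
have [v vc vN1] : exists2 v, v ^+ 2 = c & v != -1.
  have [e|ne] := eqVneq (sqrtc c) (-1); last by exists (sqrtc c); rewrite ?sqr_sqrtc.
  exists 1; first by rewrite -(sqr_sqrtc c) e sqrrN.
  by rewrite -subr_eq0 opprK (pnatr_eq0 C 2).
have v1 : normc v = 1.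
  have h : normc v * normc v = 1.
    by rewrite -Normc.normcM -expr2 vc; apply: complexI; rewrite -normC_normc c1.
  by have := normc_ge0 v; nra.
pose d (t : R) : C := (1 - t)%:C + t%:C * v.
have d0 t : 0 <= t <= 1 -> d t != 0.
  move=> ht; apply/eqP => /eqP; rewrite addr_eq0 => /eqP e.
  have /(congr1 normc) := e.
  rewrite -mulrN Normc.normcM !normc_real.
  have -> : normc (- v) = normc v by apply: complexI; rewrite -!normC_normc normrN.
  rewrite v1 mulr1 !ger0_norm; [move=> th|lra|lra].
  have t2 : t = 2^-1 by lra.
  have t0 : t%:C != 0 :> C by apply/eqP => /complexI; lra.
  move: e; rewrite {1}(_ : 1 - t = t); last by lra.
  rewrite -mulrN -{1}[t%:C]mulr1 => /(mulfI t0) h.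
  by move/eqP: vN1; apply; rewrite h opprK.
exists (fun t => (d t / `|d t|) ^+ 2); split.
- apply/subspace_continuousP => t /=; rewrite in_itv /= => /d0 dt.
  apply: cvg_within_filter.
  have cd : d t' @[t' --> t] --> d t.
    apply: cvgD.
      by apply: cvg_real_complex; apply: cvgB; [exact: cvg_cst|].
    by apply: cvgM; [exact: cvg_real_complex|exact: cvg_cst].
  have ce : (d t' / `|d t'|) @[t' --> t] --> d t / `|d t|.
    apply: cvgM; first exact: cd.
    apply: cvgV; first by rewrite normr_eq0.
    exact: cvg_norm cd.
  exact: cvgM.
- by rewrite /d subr0 mul0r addr0 normr1 divr1 expr1n.
- by rewrite /d subrr mul1r add0r normC_normc v1 divr1.
- move=> t /d0 dt; rewrite normrX normrM normfV normr_id divff ?expr1n //.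
  by rewrite normr_eq0.
Qed.

Context {n : nat}.

Lemma cvg_row (T : Type) (F : set_system T) {FF : Filter F} (f : T -> 'rV[C]_n)
    (l : 'rV[C]_n) :
  (forall j, f x 0 j @[x --> F] --> l 0 j) -> f x @[x --> F] --> l.
Proof.
move=> fl W [P Pn PW].
have : \forall x \near F, forall j, P 0 j (f x 0 j).
  by apply: filter_forall => j; exact: fl (P 0 j) (Pn 0 j).
by apply: filterS => x Px; apply: PW => i j; rewrite (ord1 i).
Qed.

Lemma cont_coord j : continuous (fun z : 'rV[C]_n => z 0 j).
Proof.
move=> z W nW; exists (fun i k => [set c | k = j -> W c]).
  move=> i k; rewrite (ord1 i); have [->|kj] := eqVneq k j.
    by apply: filterS nW => c Wc.
  by apply: filterS filterT => c _ e; move: kj; rewrite e eqxx.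
by move=> w /(_ 0 j); apply.
Qed.

End ComplexTopology.

Section Annuli.
Context {R : realType} {n : nat}.
Local Notation C := (R[i]).
Local Notation normc := (@Normc.normc R).
Local Notation I01 := (`[0, 1]%classic : set R).
Implicit Types u v w z : 'rV[C]_n.

Lemma same_orbitP z w :
  same_orbit z w <-> forall j, normc (z 0 j) = normc (w 0 j).
Proof.
split=> [[u tu ->] j|zw].
  by apply: complexI; rewrite -!normC_normc mxE normrM tu mul1r.
by apply: moment_same_orbit; apply/rowP => j; rewrite !mxE !normC_normc zw.
Qed.

(** The disc for a zero coordinate of [z] is the degenerate annulus; the second
    condition prevents the other annuli from being discs. *)
Definition annuli z (e : R) : set 'rV[C]_n := [set w | forall j,
  `|normc (w 0 j) - normc (z 0 j)| < e /\ (z 0 j != 0 -> w 0 j != 0)].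

Lemma annuli_orbit z e w w' : same_orbit w w' -> annuli z e w -> annuli z e w'.
Proof.
move=> /same_orbitP ww' zw j; have [h1 h2] := zw j; rewrite -ww'; split=> //.
by rewrite -(normc_eq0 (w' 0 j)) -ww' normc_eq0.
Qed.

Lemma nbhs_annuli z e : 0 < e -> nbhs z (annuli z e).
Proof.
move=> e0.
apply: (@filter_forall _ _ (fun j (w : 'rV[C]_n) =>
  `|normc (w 0 j) - normc (z 0 j)| < e /\ (z 0 j != 0 -> w 0 j != 0)) (nbhs z) _).
move=> j; apply: filterI.
  have cj : continuous (fun w : 'rV[C]_n => normc (w 0 j)).
    move=> w; apply: (@cvg_comp _ _ _ (fun w : 'rV[C]_n => w 0 j) normc).
      exact: cont_coord.
    exact: cont_normc.
  have /(cvgrPdist_lt (F := nbhs z))/(_ _ e0) := cj z.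
  by apply: filterS => w; rewrite distrC.
have [_|zj] := eqVneq (z 0 j) 0; first by apply: filterS filterT.
have nz : nbhs z [set w : 'rV[C]_n | w 0 j != 0].
  exact: (@cvgr_neq0 _ _ _ (nbhs z) _ _ _ (@cont_coord R n j z) zj).
by apply: filterS nz => w.
Qed.

(** An orbit has a basis of neighborhoods of this form among invariant sets: a
    point [w] of [annuli z e] is in the orbit of the point [w'] with the moduli of
    [w] and the phases of [z], and the latter is close to [z]. *)
Lemma annuli_sub (O : set 'rV[C]_n) z : tinvariant O -> nbhs z O ->
  exists2 e : R, 0 < e & annuli z e `<=` O.
Proof.
move=> invO /nbhs_ballP[e /= e0 eO].
have [eE er] : e = (complex.Re e)%:C /\ 0 < complex.Re e.
  by move: e0; case: e {eO} => a b; rewrite ltcE /= => /andP[/eqP-> a0].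
exists (complex.Re e) => // w zw.
have tw : torus R n (tact (phase z) (tinv (phase w))).
  by apply: torusM; [|apply: torusV]; exact: torus_phase.
pose w' : 'rV[C]_n := \row_j (phase z 0 j * (normc (w 0 j))%:C).
have ww' : same_orbit w' w.
  apply/same_orbitP => j; rewrite mxE Normc.normcM normc_real ger0_norm ?normc_ge0 //.
  have -> : normc (phase z 0 j) = 1 by apply: complexI; rewrite -normC_normc torus_phase.
  by rewrite mul1r.
have [t tt ->] := ww'; apply: invO => //; apply: eO; split=> // i j.
rewrite (ord1 i) -ball_normE /= eE mxE.
have -> : z 0 j = phase z 0 j * (normc (z 0 j))%:C.
  by rewrite {1}[z in LHS]fiber_phase fiber_oneE !mxE normC_normc.
rewrite -mulrBr normrM torus_phase mul1r -rmorphB normC_normc normc_real ltcR distrC.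
by have [] := zw j.
Qed.

(** At time [0] this is [w], and at time [1] the moduli are those of [v]. The
    phases are kept where [z] has a nonzero coordinate; where it has a zero they
    may be undefined, and are moved to [1]. *)
Definition radial z v (st : R * 'rV[C]_n) : 'rV[C]_n := \row_j
  ((1 - st.1)%:C * st.2 0 j + st.1%:C *
   ((if z 0 j == 0 then 1 else st.2 0 j / `|st.2 0 j|) * (normc (v 0 j))%:C)).

Lemma radial0 z v w : radial z v (0, w) = w.
Proof. by apply/rowP => j; rewrite mxE /= subr0 mul1r mul0r addr0. Qed.

Lemma normc_radial z e v s w j : annuli z e w -> 0 <= s <= 1 -> z 0 j != 0 ->
  normc (radial z v (s, w) 0 j) = (1 - s) * normc (w 0 j) + s * normc (v 0 j).
Proof.
move=> zw hs zj; rewrite mxE /= (negbTE zj); have [_ /(_ zj) wj] := zw j.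
have -> : (1 - s)%:C * w 0 j + s%:C * (w 0 j / `|w 0 j| * (normc (v 0 j))%:C) =
    ((1 - s) * normc (w 0 j) + s * normc (v 0 j))%:C * (w 0 j / `|w 0 j|).
  rewrite (_ : (_ * _ + _ : R)%:C =
    (1 - s)%:C * (normc (w 0 j))%:C + s%:C * (normc (v 0 j))%:C); last first.
    by rewrite [LHS]rmorphD !rmorphM.
  have wE : w 0 j = (normc (w 0 j))%:C * (w 0 j / `|w 0 j|).
    by rewrite -normC_normc mulrCA divff ?mulr1 // normr_eq0.
  by rewrite {1}wE; set u := w 0 j / _; ring.
rewrite Normc.normcM normc_real ger0_norm; last first.
  by have := normc_ge0 (w 0 j); have := normc_ge0 (v 0 j); nra.
have -> : normc (w 0 j / `|w 0 j|) = 1.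
  apply: complexI; rewrite -normC_normc normrM normfV normr_id divff //.
  by rewrite normr_eq0.
by rewrite mulr1.
Qed.

Lemma convex_ltr (s a b c : R) : 0 <= s <= 1 -> a < c -> b < c ->
  (1 - s) * a + s * b < c.
Proof.
move=> hs ac bc; have [->|s1] := eqVneq s 1; first by lra.
have {}s1 : s < 1 by rewrite lt_def eq_sym s1; case/andP: hs.
have : 0 < (1 - s) * (c - a) by apply: mulr_gt0; lra.
have : 0 <= s * (c - b) by apply: mulr_ge0; lra.
by lra.
Qed.

Lemma radial_annuli z e v s w : annuli z e v -> annuli z e w -> 0 <= s <= 1 ->
  annuli z e (radial z v (s, w)).
Proof.
move=> zv zw hs j; have [hw wj] := zw j; have [hv vj] := zv j.
have [z0|zj] := eqVneq (z 0 j) 0.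
  split=> //; move: hw hv; rewrite z0 Normc.normc0 !subr0.
  rewrite !ger0_norm ?normc_ge0 // => hw hv.
  rewrite mxE /= z0 eqxx mul1r.
  apply: (@le_lt_trans _ _ ((1 - s) * normc (w 0 j) + s * normc (v 0 j))).
    have nD (a b : C) : normc (a + b) <= normc a + normc b.
      by rewrite -lecR rmorphD -!normC_normc; exact: ler_normD.
    apply: le_trans (nD _ _) _; rewrite !Normc.normcM !normc_real.
    by rewrite !ger0_norm ?normc_ge0 //; lra.
  exact: convex_ltr.
have := normc_radial v zw hs zj; set r := radial _ _ _ 0 j => rE.
have [w0 v0] : 0 < normc (w 0 j) /\ 0 < normc (v 0 j).
  by rewrite !lt_def !normc_ge0 !normc_eq0 wj // vj.
have cvN a b : (1 - s) * - a + s * - b = - ((1 - s) * a + s * b) by ring.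
split=> [|_]; last first.
  rewrite -normc_eq0 rE -oppr_eq0 -cvN ltr0_neq0 //.
  by apply: convex_ltr => //; rewrite oppr_lt0.
move: hw hv; rewrite rE !ltr_norml => /andP[hw1 hw2] /andP[hv1 hv2].
have := @convex_ltr s (normc (w 0 j)) (normc (v 0 j)) (normc (z 0 j) + e) hs.
have := @convex_ltr s (- normc (w 0 j)) (- normc (v 0 j)) (e - normc (z 0 j)) hs.
by rewrite cvN => h1 h2; apply/andP; split; [have := h1|have := h2]; lra.
Qed.

Lemma radial1 z e v w : annuli z e v -> annuli z e w ->
  same_orbit v (radial z v (1, w)).
Proof.
move=> zv zw; apply/same_orbitP => j; have [z0|zj] := eqVneq (z 0 j) 0.
  rewrite mxE /= z0 eqxx subrr mul0r add0r !mul1r normc_real.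
  by rewrite ger0_norm ?normc_ge0.
by rewrite (normc_radial v zw) ?lexx ?ler01 // subrr mul0r add0r mul1r.
Qed.

Lemma cont_radial z e v : {within I01 `*` annuli z e, continuous (radial z v)}.
Proof.
apply/subspace_continuousP => -[s w] [/= _ zw].
apply: cvg_within_filter; apply: cvg_row => j.
have cs : (st.1 : R) @[st --> (s, w)] --> s by exact: cvg_fst.
have cw : (fun st : R * 'rV[C]_n => st.2 0 j) @ nbhs (s, w) --> (w 0 j : C).
  apply: (@cvg_comp _ _ _ (snd : R * 'rV[C]_n -> _) (fun w : 'rV[C]_n => w 0 j)).
    exact: cvg_snd.
  exact: cont_coord.
rewrite [in X in _ --> X]mxE /=; under eq_fun do rewrite mxE /=.
apply: cvgD.
  apply: cvgM; last exact: cw.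
  by apply: cvg_real_complex; apply: cvgB; [exact: cvg_cst|exact: cs].
apply: cvgM; first exact: cvg_real_complex.
apply: cvgM; last exact: cvg_cst.
case: ifPn => zj; first exact: cvg_cst.
have [_ /(_ zj) wj] := zw j.
apply: cvgM; first exact: cw.
apply: cvgV; first by rewrite normr_eq0.
exact: cvg_norm cw.
Qed.

End Annuli.

(** * The orbit map *)

Section Atlas.
Context {R : realType} {X : topologicalType} {n : nat} (A : weakly_standard_atlas R X n).
Local Notation I01 := (`[0, 1]%classic : set R).
Local Notation mu := (orbit_map A).
Local Notation fiber y := [set y' : X | mu y = mu y'].

(** Two points of a fiber differ, in a chart, by an element of the torus, which
    is joined to the unit coordinatewise. *)
Lemma orbit_fiber_connected x y : mu x = mu y ->
  exists p, fiber_path (R := R) mu x y p.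
Proof.
move=> xy; have [a ax] := atlas_cover A x.
have [ay [u tu yE]] : dom (A a) y /\ same_orbit (A a x) (A a y).
  exact/(orbit_mapP _ ax).
pose g j := projT1 (cid (circle_path (tu j))).
have gP j : [/\ {within `[0, 1], continuous (g j)}, g j 0 = 1, g j 1 = u 0 j &
    forall t, 0 <= t <= 1 -> `|g j t| = 1] by rewrite /g; case: cid.
pose z t : 'rV[R[i]]_n := tact (\row_j g j t) (A a x).
have [_ _ _ [[_ cinv] _ _ K _]] := atlas_chart a.
have zP t : I01 t -> [/\ dom (A a) (chart_inv (A a) (z t)),
    A a (chart_inv (A a) (z t)) = z t & mu (chart_inv (A a) (z t)) = mu x].
  move=> It; apply: chart_image_orbit => //.
  exists (\row_j g j t) => // j; rewrite mxE; have [_ _ _ g1] := gP j; exact: g1.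
exists (fun t => chart_inv (A a) (z t)); split.
- apply: (within_comp (B := A a @` dom (A a)) _ cinv); last first.
    by move=> t /zP[? ? _]; exists (chart_inv (A a) (z t)).
  apply/subspace_continuousP => t It; apply: cvg_row => j.
  rewrite /z [in X in _ --> X]mxE; under eq_fun do rewrite mxE.
  apply: cvgM; last exact: cvg_cst.
  rewrite mxE; under eq_fun do rewrite mxE.
  by have [/subspace_continuousP/(_ t It)] := gP j.
- rewrite (_ : z 0 = A a x) ?K // -[RHS]tact1; congr tact.
  by apply/rowP => j; rewrite !mxE; have [] := gP j.
- rewrite (_ : z 1 = A a y) ?K // yE; congr tact.
  by apply/rowP => j; rewrite !mxE; have [] := gP j.
- by move=> t /zP[].
Qed.

(** The set [annuli z e], read in a chart, is the neighborhood: its loops are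
    freely homotopic to loops in the fiber of any of its points [y], by [radial]. *)
Lemma orbit_nbhs (x : X) : exists N : set X,
  [/\ nbhs x N, forall y y', N y -> mu y = mu y' -> N y' &
      forall y, N y -> fillable (R := R) (fiber y) -> fillable (R := R) N].
Proof.
have [a ax] := atlas_cover A x.
have [oa oO invO [[ca cinv] _ _ K K']] := atlas_chart a.
have zO : nbhs (A a x) (A a @` dom (A a)).
  by apply: open_nbhs_nbhs; split=> //; exists x.
have [e e0 eO] := annuli_sub invO zO.
set z := A a x in zO eO.
exists [set y | dom (A a) y /\ annuli z e (A a y)]; split.
- apply: filterI; first exact: open_nbhs_nbhs.
  have cax : {for x, continuous (A a)}.
    by have := ca; rewrite continuous_open_subspace // => /(_ x); apply; exact/mem_set.
  exact: cax (nbhs_annuli z e0).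
- move=> y y' [ay zy] yy'.
  have [ay' oy] : dom (A a) y' /\ same_orbit (A a y) (A a y').
    exact/(orbit_mapP _ ay).
  by split=> //; exact: annuli_orbit zy.
- move=> y [ay zy] fy f cf Nf.
  pose h (sq : R * (R * R)) := chart_inv (A a) (radial z (A a y) (sq.1, A a (f sq.2))).
  have hO s q : I01 s -> circ q -> annuli z e (radial z (A a y) (s, A a (f q))).
    by rewrite /= in_itv /= => Is /Nf[_ zq]; exact: radial_annuli.
  have ch : {within I01 `*` circ, continuous h}.
    apply: (within_comp (B := A a @` dom (A a)) _ cinv); last first.
      by move=> [s q] [/= Is cq]; apply: eO; exact: hO.
    apply: (within_comp (f := fun sq : R * (R * R) => (sq.1, A a (f sq.2)))
      (g := radial z (A a y)) _ (cont_radial (z := z) (e := e) (v := A a y))).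
      apply: within_pair.
        by apply: continuous_subspaceT; exact: cont_fst.
      apply: (within_comp (f := snd) (g := A a \o f) (B := circ)); last by move=> [s q] [].
        by apply: continuous_subspaceT; exact: cont_snd.
      by apply: within_comp cf ca _ => q /Nf[].
    by move=> [s q] [/= Is /Nf[]].
  have [|F cF FE] := fillable_homotopy fy ch.
    move=> q /Nf[_ zq] /=.
    by have [_ _ ->] := chart_image_orbit ay (radial1 zy zq).
  exists F => // q cq; rewrite FE // /h /= radial0 K //.
  by have [] := Nf _ cq.
Qed.

(** The fiber over a vertex is a point, since the torus fixes the origin. *)
Lemma vertex_fillable : stratum A 0 !=set0 ->
  exists x, fillable (R := R) (fiber x).
Proof.
move=> [b [a /orbit_chart_domP[x ax ->]]].
rewrite (orbit_chartE ax) => /eqP; rewrite cards_eq0 => /eqP m0.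
exists x => f _ fx; exists (cst x).
  by apply: continuous_subspaceT => z; exact: cvg_cst.
move=> q /fx /esym/(orbit_mapP _ ax)[aq /same_orbitP xq].
apply: chart_inj ax aq _; apply/rowP => j.
have xj : A a x 0 j = 0.
  apply/Normc.eq0_normc/eqP.
  have : j \notin [set j | moment (A a x) 0 j != 0]%SET by rewrite m0 inE.
  by rewrite inE negbK mxE normC_normc -rmorphXn /= expf_eq0.
apply/esym; rewrite xj; apply: Normc.eq0_normc.
by rewrite -xq xj Normc.normc0.
Qed.

(** The points whose fiber is fillable form an open and closed set [G], because
    by [orbit_nbhs] each point has a neighborhood on which either all fibers are
    fillable or none is. *)
Lemma orbit_nbhs_fillable : connected [set: X] -> stratum A 0 !=set0 ->
  forall x : X, exists N : set X, [/\ nbhs x N, fillable (R := R) N &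
    forall y y', N y -> mu y = mu y' -> N y'].
Proof.
move=> conX /vertex_fillable[x1 fx1].
pose G : set X := [set x | fillable (R := R) (fiber x)].
have NG (N : set X) y y' : (forall y y', N y -> mu y = mu y' -> N y') ->
    (forall y, N y -> fillable (R := R) (fiber y) -> fillable (R := R) N) ->
    N y -> N y' -> G y -> G y'.
  move=> sat fN Ny Ny' /(fN y Ny); apply: fillableS => w; exact: sat.
have oG : open G.
  rewrite openE => x Gx; have [N [nN sat fN]] := orbit_nbhs x.
  apply: filterS (nN) => y Ny; exact: (NG N x y sat fN (nbhs_singleton nN) Ny Gx).
have cG : closed G.
  move=> x clGx; have [N [nN sat fN]] := orbit_nbhs x.
  have [y [Gy Ny]] := clGx _ nN.
  exact: (NG N y x sat fN Ny (nbhs_singleton nN) Gy).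
have GT : G = [set: X].
  by apply: conX; [exists x1|exists G; rewrite ?setTI|exists G; rewrite ?setTI].
move=> x; have [N [nN sat fN]] := orbit_nbhs x.
exists N; split=> //; apply: (fN x); first exact: nbhs_singleton.
by have : G x by rewrite GT.
Qed.

End Atlas.

Theorem theorem8p1 (R : realType) (n : nat) (X : topologicalType)
    (X_compact : compact [set: X]) (X_hausdorff : hausdorff_space X)
    (X_connected : connected [set: X])
    (T : weakly_standard_atlas R X n -> Prop) (T_action : local_torus_action T)
    (A : weakly_standard_atlas R X n) (A_T : T A)
    (euler0 : euler_class_vanishes A)
    (b0 : orbit_space A) (b0_interior : stratum A n b0)
    (x0 : X) (x0_b0 : orbit_map A x0 = b0)
    (vertex : stratum A 0 !=set0) :
  group_isomorphism (pi1_map (R := R) (orbit_map_continuous (A := A)) x0_b0).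
Proof.
have /euler_class_vanishesP[s [s_cont sK]] := euler0.
apply: (pi1_map_isomorphism (s := s)) => //.
- exact: orbit_fiber_connected.
- exact: orbit_nbhs_fillable.
Qed.
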